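(* Let $G_D$ be a data tensor network with $N$ edges to be sketched and let $T_0=\{(U_1,V_1),\dots,(U_{N_D-1},V_{N_D-1})\}$ be a given contraction tree of $G_D$. For any embedding $G_E$ satisfying the $(\epsilon,\delta)$-accurate sufficient condition (with only one output sketch dimension) and any contraction tree $T_B$ of $(G_D,G_E)$ constrained on $T_0$, the sketching asymptotic cost must be lower bounded by $$\Omega\left(\sum_{j=1}^N t(e_j)+\sum_{i\in\mathcal S}a_ib_ic_id_im^2+Nm^{2.5}+\sum_{i\in\mathcal I}z_i\right),$$ where $m=\Omega(N\log(1/\delta)/\epsilon^2)$ is the sketch size, $t(e_j)$ is the optimal asymptotic cost to sketch the sub tensor network $X(e_j)$ (the sub network contracted by $\mathcal D(e_j)$) with an adjacent matrix of the Kronecker product embedding, and $$z_i=a_ib_ic_id_i\cdot\min\left(\exp(\mathrm{cut}_{G_S}(U_i\cup V_i)),\,m\right).$$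
   Context: **Tensor networks.** A tensor network is an undirected hypergraph $G=(V,E,w)$: each vertex is a tensor, each hyperedge a tensor dimension, $w(e)\ge0$ the natural log of the dimension size. A hyperedge is uncontracted if it has a dangling end (not adjacent to a vertex), and contracted otherwise (adjacent to at least two vertices). **Data and embedding.** The data $G_D=(V_D,E_D,w)$, $N_D=|V_D|$, is a hypergraph tensor network with a set $\bar E=\{e_1,\dots,e_N\}\subseteq E_D$ of uncontracted edges to be sketched; $e_j$ is adjacent to exactly one vertex $v_j\in V_D$, the $v_j$ are distinct, and $s_j=\exp(w(e_j))$. Data vertices not adjacent to $\bar E$ are allowed. An embedding is a graph tensor network $G_E=(V_E,E_E,w)$, $N_E=|V_E|$, with $\bar E\subseteq E_E$: in the combined network $e_j$ joins $v_j$ to an embedding vertex; the other edges of $E_E$ join two embedding vertices or are uncontracted output edges $E_1\subset E_E$ adjacent to one embedding vertex. The sketch size is $m=\exp(\sum_{e\in E_1}w(e))$. Standing assumption: each $s_j>m$. The combined network is $G=(V,E,w)$, $V=V_E\cup V_D$, $E=E_E\cup E_D$; also $L=(V,E_E,w)$, $R=(V,E\setminus E_E,w)$. **Cuts and cost.** For a (hyper)graph $H$ on $V$ and disjoint $A,B\subseteq V$: $\mathrm{cut}_H(A,B)$ is the total weight of hyperedges adjacent to both $A$ and $B$; $\mathrm{cut}_H(A,* )$ the total weight of uncontracted hyperedges adjacent only to vertices of $A$; $\mathrm{cut}_H(A)=\mathrm{cut}_H(A,V\setminus A)+\mathrm{cut}_H(A,* )$. $\mathrm{cost}_H(A,B)=\mathrm{cut}_H(A)+\mathrm{cut}_H(B)-\mathrm{cut}_H(A,B)$.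 **Contraction trees.** A contraction tree of a network on $V$ is a rooted binary tree whose vertices are subsets of $V$, leaves are singletons, the root is $V$, and each internal vertex $W$ is the disjoint union of its children $W_1,W_2$ (the contraction $(W_1,W_2)$). Contracting $(W_1,W_2)$ costs $\exp(\mathrm{cost}_G(W_1,W_2))$, and the (sketching asymptotic) cost of $T_B$ is the sum over all contractions, considered up to absolute constants. $T_B$ for $(G_D,G_E)$ is constrained on $T_0$ (a contraction tree of $G_D$) if for each $(A,B)\in T_0$ there is $(\hat A,\hat B)\in T_B$ with $\hat A\cap V_D=A$, $\hat B\cap V_D=B$. **Sufficient condition.** A sketching linearization $G_S$ is obtained by choosing an ordering of $V$ in which data vertices precede embedding vertices, and directing every contracted edge of $L$ to its higher-indexed endpoint and every uncontracted edge outward. $\mathrm{cut}_{G_S}(A)$ is the total weight of edges leaving $A\subseteq V$ (including outward dangling ones); for $A\subseteq V_D$ it is $\sum_{j:v_j\in A}\log s_j$. The embedding satisfies the $(\epsilon,\delta)$-accurate sufficient condition with one output sketch dimension if $|E_1|=1$, $m=\Theta(N_E\log(1/\delta)/\epsilon^2)$, and some sketching linearization has effective sketch dimension of size $\Omega(N_E\log(1/\delta)/\epsilon^2)$ at each embedding vertex, taken as $\mathrm{cut}_{G_S}(v)\ge\log m$ for all $v\in V_E$. **Notation for $T_0$.** $a_i=\exp(\mathrm{cut}_R(U_i)-\mathrm{cut}_R(U_i,V_i))$, $c_i=\exp(\mathrm{cut}_R(V_i)-\mathrm{cut}_R(U_i,V_i))$, $d_i=\exp(\mathrm{cut}_R(U_i\cup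 V_i))/(a_ic_i)$, $b_i=\exp(\mathrm{cut}_R(U_i,V_i))/d_i$. The contractions $(U_i,V_i)$ of $T_0$ are partitioned into: $\mathcal S$, those with both $U_i$ and $V_i$ adjacent to edges of $\bar E$; $\mathcal D(e_j)$, those for which $e_j$ is the only edge of $\bar E$ adjacent to $U_i\cup V_i$; $\mathcal I$, the remaining ones. $X(e_j)$ is the sub network contracted by $\mathcal D(e_j)$: its tensors are $v_j$ and, for $i\in\mathcal D(e_j)$, the (possibly intermediate) tensor among $U_i,V_i$ not adjacent to $e_j$; $X(e_j)=v_j$ if $\mathcal D(e_j)=\emptyset$. $t(e_j)$ is the minimal total cost of contracting $X(e_j)$ together with one $s_j\times m$ matrix attached to $e_j$, following the contractions $\mathcal D(e_j)$ and applying the matrix at the best step (for $\mathcal D(e_j)=\emptyset$, $t(e_j)=\exp(\mathrm{cut}_G(v_j))\cdot m$).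
   Formalization: The term Nm^{2.5} is claimed only for N ≥ 2 (false for N=1: one data and one embedding tensor, s_1=m+1, cost m(m+1)); m=Ω(N log(1/δ)/ε²) is claimed only when N ≤ N_E (false for one dense embedding tensor joined to all e_j). *)

(* Defs.v *)
From HB Require Import structures.
From mathcomp Require Import all_boot all_order all_algebra.
From mathcomp Require Import all_classical all_reals all_analysis.

Set Implicit Arguments.
Unset Strict Implicit.
Unset Printing Implicit Defensive.

Import Order.TTheory GRing.Theory Num.Theory.
Local Open Scope ring_scope.

(* A hypergraph tensor network: [ends e] is the set of vertices adjacent to
   the hyperedge [e], [dangling e] says that [e] is uncontracted, and [wt e]
   is the natural logarithm of the dimension size. *)
Record network (R : realType) (V E : finType) := Network {
  ends : E -> {set V};
  dangling : E -> bool;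
  wt : E -> R }.

Definition well_formed (R : realType) (V E : finType) (G : network R V E) :=
  forall e, 0 <= wt G e /\ ((if dangling G e then 1 else 2) <= #|ends G e|)%N.

(* The cuts below are those of H = (V, F, w), where F is a set of edges of G;
   F = setT gives G itself. *)
Section Cuts.
Variables (R : realType) (V E : finType) (G : network R V E) (F : {set E}).
Implicit Types A B : {set V}.

Definition adjacent (e : E) A : bool := ends G e :&: A != finset.set0.

(* cut_H(A, B) *)
Definition cut2 A B : R :=
  \sum_(e in F | adjacent e A && adjacent e B) wt G e.

(* cut_H(A, * ) *)
Definition cut_open A : R :=
  \sum_(e in F | dangling G e && (ends G e \subset A)) wt G e.

Definition cut A : R := cut2 A (~: A) + cut_open A.

Definition cost A B : R := cut A + cut B - cut2 A B.

End Cuts.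

(* A contraction tree is represented by its binary-tree skeleton; the subset
   of V at a node is the set [supp] of the leaves below it. *)
Inductive ctree (V : finType) :=
  | CLeaf of V
  | CNode of ctree V & ctree V.

Fixpoint supp (V : finType) (T : ctree V) : {set V} :=
  match T with
  | CLeaf v => [set v]
  | CNode T1 T2 => supp T1 :|: supp T2
  end.

Fixpoint ctree_disjoint (V : finType) (T : ctree V) : bool :=
  match T with
  | CLeaf _ => true
  | CNode T1 T2 =>
      [&& [disjoint supp T1 & supp T2], ctree_disjoint T1 & ctree_disjoint T2]
  end.

Definition contraction_tree (V : finType) (T : ctree V) : bool :=
  ctree_disjoint T && (supp T == [set: V]).

Fixpoint contractions (V : finType) (T : ctree V) : seq ({set V} * {set V}) :=
  match T with
  | CLeaf _ => [::]
  | CNode T1 T2 =>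
      (supp T1, supp T2) :: contractions T1 ++ contractions T2
  end.

(* The two children of a node are not ordered. *)
Definition is_contraction (V : finType) (T : ctree V) (A B : {set V}) : bool :=
  ((A, B) \in contractions T) || ((B, A) \in contractions T).

Definition tree_cost (R : realType) (V E : finType) (G : network R V E)
    (T : ctree V) : R :=
  \sum_(p <- contractions T) expR (cost G [set: E] p.1 p.2).

(* [e j] is the j-th edge to be sketched and [v j] the only vertex adjacent
   to it; the e_j are distinct because the v_j are. *)
Record sketch_data (R : realType) (N : nat) (VD ED : finType)
    (GD : network R VD ED) (e : 'I_N -> ED) (v : 'I_N -> VD) : Prop := {
  data_wf : well_formed GD;
  data_open : forall j, dangling GD (e j);
  data_ends : forall j, ends GD (e j) = [set v j];
  data_inj : injective v }.

(* The edges of an embedding are the e_j, as [inl j], and further edges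
   [inr f].  Within G_E the edge e_j is uncontracted: its data end only
   appears in the combined network. *)
Record embedding (R : realType) (N : nat) (VD ED VE FE : finType)
    (GD : network R VD ED) (e : 'I_N -> ED)
    (GE : network R VE ('I_N + FE)%type) : Prop := {
  emb_wf : well_formed GE;
  emb_input : forall j, dangling GE (inl j) /\ #|ends GE (inl j)| = 1%N;
  emb_input_wt : forall j, wt GE (inl j) = wt GD (e j);
  emb_graph : forall f,
    #|ends GE (inr f)| = (if dangling GE (inr f) then 1 else 2)%N }.

Definition output_edges (R : realType) (N : nat) (VE FE : finType)
    (GE : network R VE ('I_N + FE)%type) : {set FE} :=
  [set f | dangling GE (inr f)].

Definition sketch_size (R : realType) (N : nat) (VE FE : finType)
    (GE : network R VE ('I_N + FE)%type) : R :=
  expR (\sum_(f in output_edges GE) wt GE (inr f)).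

(* The combined network G: the copies of e_j in G_D and in G_E are glued into
   one contracted edge. *)
Definition combine (R : realType) (N : nat) (VD ED VE FE : finType)
    (GD : network R VD ED) (e : 'I_N -> ED)
    (GE : network R VE ('I_N + FE)%type) :
    network R (VD + VE)%type (ED + FE)%type :=
  {| ends := fun x => match x with
       | inl d => [set inl u | u in ends GD d] :|:
                  \bigcup_(j | e j == d) [set inr y | y in ends GE (inl j)]
       | inr f => [set inr y | y in ends GE (inr f)]
       end;
     dangling := fun x => match x with
       | inl d => dangling GD d && (d \notin codom e)
       | inr f => dangling GE (inr f)
       end;
     wt := fun x => match x with
       | inl d => wt GD d
       | inr f => wt GE (inr f)
       end |}.

(* E_E as a set of edges of the combined network: L = (V, emb_edges e, w) and
   R = (V, ~: emb_edges e, w). *)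
Definition emb_edges (N : nat) (ED FE : finType) (e : 'I_N -> ED) :
    {set (ED + FE)%type} :=
  [set x : (ED + FE)%type | match x with
                            | inl d => d \in codom e
                            | inr _ => true
                            end].

Definition constrained (VD VE : finType) (T0 : ctree VD)
    (TB : ctree (VD + VE)%type) : Prop :=
  forall A B, is_contraction T0 A B ->
  exists A' B', [/\ is_contraction TB A' B',
    [set u | inl u \in A'] = A & [set u | inl u \in B'] = B].

Section Linearization.
Variables (R : realType) (N : nat) (VD ED VE FE : finType).
Variables (GD : network R VD ED) (e : 'I_N -> ED).
Variables (GE : network R VE ('I_N + FE)%type).
Implicit Type s : (VD + VE)%type -> nat.

Let G := combine GD e GE.

(* The ordering of V is given by the positions of the vertices. *)
Definition linearization s : Prop :=
  injective s /\ forall u y, (s (inl u) < s (inr y))%N.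

Definition leaves s (x : (ED + FE)%type) (A : {set (VD + VE)%type}) : bool :=
  if dangling G x then adjacent G x A
  else [exists a in ends G x :&: A, exists b in ends G x :\: A,
          (s a < s b)%N].

(* cut_{G_S}(A) *)
Definition cut_lin s (A : {set (VD + VE)%type}) : R :=
  \sum_(x in emb_edges FE e | leaves s x A) wt G x.

(* The (eps, delta)-accurate sufficient condition with one output sketch
   dimension; k1 and k2 are the implied constants of the Theta. *)
Definition accurate_condition (k1 k2 eps delta : R) : Prop :=
  [/\ #|output_edges GE| = 1%N,
      k1 * (#|VE|%:R * ln (1 / delta) / eps ^+ 2) <= sketch_size GE
        <= k2 * (#|VE|%:R * ln (1 / delta) / eps ^+ 2)
    & exists s, linearization s /\
        forall y : VE, ln (sketch_size GE) <= cut_lin s [set inr y] ].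

End Linearization.

Section DataTree.
Variables (R : realType) (N : nat) (VD ED VE FE : finType).
Variables (GD : network R VD ED) (e : 'I_N -> ED) (v : 'I_N -> VD).
Variables (GE : network R VE ('I_N + FE)%type).
Implicit Types (p : {set VD} * {set VD}) (A : {set VD}).

Let toV A : {set (VD + VE)%type} := [set inl u | u in A].
Let cutR A := cut (combine GD e GE) (~: emb_edges FE e) (toV A).
Let cut2R A B := cut2 (combine GD e GE) (~: emb_edges FE e) (toV A) (toV B).

Definition coef_a p : R := expR (cutR p.1 - cut2R p.1 p.2).
Definition coef_c p : R := expR (cutR p.2 - cut2R p.1 p.2).
Definition coef_d p : R :=
  expR (cutR (p.1 :|: p.2)) / (coef_a p * coef_c p).
Definition coef_b p : R := expR (cut2R p.1 p.2) / coef_d p.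
Definition abcd p : R := coef_a p * coef_b p * coef_c p * coef_d p.

Definition sketched A : {set 'I_N} := [set j | v j \in A].

Definition in_S p : bool :=
  (sketched p.1 != finset.set0) && (sketched p.2 != finset.set0).
Definition in_D j p : bool := sketched (p.1 :|: p.2) == [set j].
Definition in_I p : bool := ~~ in_S p && ~~ [exists j, in_D j p].

Definition z_term (s : (VD + VE)%type -> nat) p : R :=
  abcd p * Num.min (expR (cut_lin GD e GE s (toV (p.1 :|: p.2))))
                   (sketch_size GE).

End DataTree.

Section SubNetworkCost.
Variables (R : realType) (N : nat) (VD ED : finType).
Variables (GD : network R VD ED) (e : 'I_N -> ED) (v : 'I_N -> VD).
Variables (T0 : ctree VD) (m : R) (j : 'I_N).

(* One s_j x m matrix with input edge e_j. *)
Definition matrix_embedding : network R unit ('I_1 + unit)%type :=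
  {| ends := fun _ => [set tt];
     dangling := fun _ => true;
     wt := fun x => match x with
       | inl _ => wt GD (e j)
       | inr _ => ln m
       end |}.

Definition matrix_net : network R (VD + unit)%type (ED + unit)%type :=
  combine GD (fun _ : 'I_1 => e j) matrix_embedding.

Definition plain (A : {set VD}) : {set (VD + unit)%type} :=
  [set inl u | u in A].

(* The tensor contracted from A once the matrix has been applied: the matrix
   is part of it when A contains v_j. *)
Definition with_matrix (A : {set VD}) : {set (VD + unit)%type} :=
  plain A :|: (if v j \in A then [set inr tt] else finset.set0).

(* The contractions in D(e_j) lie on one path of T_0 going up from v_j, so the
   tensors holding e_j are successively those of [stages].  Applying the
   matrix to the tensor A of that chain, the contractions of D(e_j) below A
   are done without the matrix, and the later ones with it. *)
Definition stages : seq {set VD} :=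
  [set v j] :: [seq p.1 :|: p.2 | p <- contractions T0 & in_D v j p].

Definition cost_at (A : {set VD}) : R :=
  expR (cost matrix_net [set: _] (plain A) [set inr tt]) +
  \sum_(p <- contractions T0 | in_D v j p)
    if p.1 :|: p.2 \subset A
    then expR (cost matrix_net [set: _] (plain p.1) (plain p.2))
    else expR (cost matrix_net [set: _] (with_matrix p.1) (with_matrix p.2)).

(* t(e_j) *)
Definition t_cost : R :=
  \big[Num.min/cost_at [set v j]]_(A <- stages) cost_at A.

End SubNetworkCost.

(* Main.v *)
Require Import Defs.
From mathcomp Require Import all_boot all_order all_algebra.
From mathcomp Require Import all_classical all_reals all_analysis.
From mathcomp Require Import lra.
From mathcomp Require Import fintype finset.
Require Import Defs.

Import Order.TTheory GRing.Theory Num.Theory.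
Local Open Scope ring_scope.

Set Implicit Arguments.
Unset Strict Implicit.
Unset Printing Implicit Defensive.

(** The cost of a contraction [(A, B)] is the total weight of its dimensions, and
    it splits into a data part, which depends only on the data vertices of [A]
    and [B], and an embedding part.  For a contraction of the data tree the data
    part is the logarithm of [a b c d].

    The embedding part is bounded below through the linearization of the
    sufficient condition.  Call the embedding vertices and the [v j] active.
    Each of them has outgoing edges of total weight at least [l = ln m], and all
    edges point to later active vertices; so the edges whose tail is the last
    active vertex of a set all leave the set.  Hence a contraction with one
    active side has embedding part at least [l], and with two active sides at
    least [2 l], since different vertices are tails of different edges.  This
    gives the sums over [S] and [I] ([bound_S], [bound_I]), because each
    contraction of the data tree has a copy in the constrained tree.

    For [t(e j)], consider the contraction at which [v j] first meets another
    active vertex.  The data on the side of [v j] is a stage of the chain of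
    [e j], because the nodes of the constrained tree have nodes of the data tree
    as data parts ([node_data_part]).  The contraction pays for the application
    of the matrix at this stage, and the copies of the contractions in [D(e j)]
    pay for the others ([t_charge], [bound_t]).

    For [N m ^ 2.5], two sets with sketched vertices are merged [N - 1] times.
    Such a merge costs [m ^ 2.5], or its result has an output of weight at least
    [1.5 l], so that the next contraction with an active set costs [m ^ 2.5], or
    one of its sides has an input of weight more than [0.5 l], so that the
    contraction forming this side did ([outw_merge_in]).  A potential keeps the
    account ([potentialU], [tree_potential], [bound_N]). *)

(** * Nodes of a contraction tree *)

Section Trees.
Variable V : finType.
Implicit Types (T : ctree V) (A B C : {set V}) (u : V).

Fixpoint nodes T : seq {set V} :=
  supp T :: match T with
            | CLeaf _ => [::]
            | CNode T1 T2 => nodes T1 ++ nodes T2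
            end.

Lemma supp_node T : supp T \in nodes T.
Proof. by case: T => [u|T1 T2]; rewrite inE eqxx. Qed.

Lemma node_sub T A : A \in nodes T -> A \subset supp T.
Proof.
elim: T => [u|T1 IH1 T2 IH2] /=; rewrite inE; first by rewrite ?orbF => /eqP->.
case/orP=> [/eqP-> //|]; rewrite mem_cat => /orP[/IH1|/IH2] sA.
  exact: (subset_trans sA (subsetUl _ _)).
exact: (subset_trans sA (subsetUr _ _)).
Qed.

Lemma node_neq0 T A : A \in nodes T -> A != set0.
Proof.
have supp0 T' : supp T' != set0.
  by elim: T' => [u|T1 IH1 T2 _] /=; rewrite ?setU_eq0 ?(negPf IH1) // -card_gt0 cards1.
elim: T => [u|T1 IH1 T2 IH2]; rewrite /= inE; first by move=> /eqP->; exact: supp0 (CLeaf u).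
case/orP=> [/eqP->|]; first exact: (supp0 (CNode T1 T2)).
by rewrite mem_cat => /orP[/IH1|/IH2].
Qed.

Lemma leaf_node T u : u \in supp T -> [set u] \in nodes T.
Proof.
elim: T => [w|T1 IH1 T2 IH2] /=; first by rewrite !inE => /eqP->.
by rewrite !inE mem_cat => /orP[/IH1->|/IH2->]; rewrite ?orbT.
Qed.

Lemma mem_contractionsP T A B : (A, B) \in contractions T ->
  ctree_disjoint T ->
  [/\ A \in nodes T, B \in nodes T, A :|: B \in nodes T & [disjoint A & B]].
Proof.
elim: T => [u|T1 IH1 T2 IH2] //=; rewrite in_cons => /orP[/eqP[-> ->]|AB].
  case/and3P=> dT _ _.
  by rewrite !inE !mem_cat !supp_node eqxx ?orbT.
case/and3P=> _ d1 d2; move: AB; rewrite mem_cat => /orP[AB|AB].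
  by have [a b c d] := IH1 AB d1; rewrite !inE !mem_cat a b c ?orbT.
by have [a b c d] := IH2 AB d2; rewrite !inE !mem_cat a b c ?orbT.
Qed.

Lemma is_contractionP T A B : ctree_disjoint T -> is_contraction T A B ->
  [/\ A \in nodes T, B \in nodes T, A :|: B \in nodes T & [disjoint A & B]].
Proof.
move=> dT /orP[] /mem_contractionsP/(_ dT)[] // a b c d.
by split=> //; rewrite ?(setUC A B) // disjoint_sym.
Qed.

Lemma node_laminar T A B : ctree_disjoint T -> A \in nodes T -> B \in nodes T ->
  [\/ A \subset B, B \subset A | [disjoint A & B]].
Proof.
elim: T => [u|T1 IH1 T2 IH2] /=.
  by rewrite !inE => _ /eqP-> /eqP->; constructor 1.
case/and3P=> dT d1 d2 nA nB.
have sA : A \subset supp (CNode T1 T2) by apply: node_sub.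
have sB : B \subset supp (CNode T1 T2) by apply: node_sub.
move: nA; rewrite inE => /orP[/eqP->|]; first by constructor 2.
move: nB; rewrite inE => /orP[/eqP->|]; first by constructor 1.
rewrite !mem_cat => /orP[nB|nB] /orP[nA|nA]; try by [apply: IH1|apply: IH2].
  constructor 3; rewrite disjoint_sym.
  exact: (disjointWl (node_sub nB) (disjointWr (node_sub nA) dT)).
constructor 3; exact: (disjointWl (node_sub nA) (disjointWr (node_sub nB) dT)).
Qed.

Lemma meeting_nodes T A B u : ctree_disjoint T -> A \in nodes T ->
  B \in nodes T -> u \in A -> u \in B -> A \subset B \/ B \subset A.
Proof.
move=> dT nA nB uA uB; have [] := node_laminar dT nA nB; [by left|by right|].
by move=> /disjointFr/(_ uA); rewrite uB.
Qed.

(** [A :|: B] and [C] share the points of [A], hence are nested; a node [C]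
    strictly between [A] and [A :|: B] would meet [B] without containing it or
    being contained in it. *)
Lemma parent_sub T A B C : ctree_disjoint T -> is_contraction T A B ->
  C \in nodes T -> A \proper C -> A :|: B \subset C.
Proof.
move=> dT cAB nC /properP[sAC [x xC xA]].
have [nA nB nAB dAB] := is_contractionP dT cAB.
have /set0Pn[u uA] := node_neq0 nA.
have uC : u \in C := subsetP sAC _ uA.
have uAB : u \in A :|: B by rewrite inE uA.
have [//|sC] := meeting_nodes dT nAB nC uAB uC.
have xB : x \in B by have := subsetP sC _ xC; rewrite inE (negPf xA).
have [sB|sB] := meeting_nodes dT nB nC xB xC; first by rewrite subUset sAC.
by have := subsetP sB _ uC; rewrite (disjointFr dAB uA).
Qed.

Lemma sibling_uniq T A B C : ctree_disjoint T -> is_contraction T A B ->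
  is_contraction T A C -> B = C.
Proof.
move=> dT.
have half B' C' : is_contraction T A B' -> is_contraction T A C' -> B' \subset C'.
  move=> cB cC; have [_ nB _ dB] := is_contractionP dT cB.
  have [_ nC nAC dC] := is_contractionP dT cC.
  have pAC : A \proper A :|: C'.
    have /set0Pn[u uC] := node_neq0 nC.
    rewrite properE subsetUl; apply/subsetPn; exists u; first by rewrite inE uC orbT.
    by rewrite (disjointFl dC uC).
  have := parent_sub dT cB nAC pAC; rewrite subUset => /andP[_ /subsetP sB].
  apply/subsetP=> x xB; have := sB x xB; rewrite inE (disjointFl dB xB) //.
by move=> cB cC; apply/eqP; rewrite eqEsubset !half.
Qed.

Lemma node_sibling T A : A \in nodes T -> A != supp T ->
  exists B, is_contraction T A B.
Proof.
rewrite /is_contraction; elim: T => [u|T1 IH1 T2 IH2] /=; rewrite inE.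
  by rewrite ?orbF => /eqP-> /eqP.
case/orP=> [/eqP->|]; rewrite ?eqxx // mem_cat => /orP[nA|nA] _.
  have [->|A1] := eqVneq A (supp T1); first by exists (supp T2); rewrite inE eqxx.
  have [B /orP[AB|AB]] := IH1 nA A1; exists B;
  by rewrite !inE !mem_cat AB ?orbT.
have [->|A1] := eqVneq A (supp T2).
  by exists (supp T1); rewrite !inE eqxx ?orbT.
have [B /orP[AB|AB]] := IH2 nA A1; exists B;
by rewrite !inE !mem_cat AB ?orbT.
Qed.

Lemma node_inv T A : A \in nodes T ->
  (exists u, A = [set u]) \/
  (exists2 p, p \in contractions T & A = p.1 :|: p.2).
Proof.
elim: T => [u|T1 IH1 T2 IH2] /=; rewrite inE.
  by rewrite ?orbF => /eqP->; left; exists u.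
case/orP=> [/eqP->|].
  by right; exists (supp T1, supp T2) => //; rewrite inE eqxx.
rewrite mem_cat => /orP[/IH1|/IH2] [[u ->]|[p pT ->]]; try by left; exists u.
  by right; exists p => //; rewrite inE mem_cat pT orbT.
by right; exists p => //; rewrite inE mem_cat pT !orbT.
Qed.

Lemma contractions_uniq T : ctree_disjoint T -> uniq (contractions T).
Proof.
elim: T => [u|T1 IH1 T2 IH2] //= /and3P[dT d1 d2].
rewrite cat_uniq IH1 // IH2 // andbT /=; apply/andP; split.
  (* a contraction inside one child has no part in the other child *)
  rewrite mem_cat; apply/negP=> /orP[] /mem_contractionsP.
    move=> /(_ d1)[_ /node_sub sb _ _].
    have /set0Pn[u uT] := node_neq0 (supp_node T2).
    by have := disjointFl dT uT; rewrite (subsetP sb _ uT).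
  move=> /(_ d2)[/node_sub sb _ _ _].
  have /set0Pn[u uT] := node_neq0 (supp_node T1).
  by have := disjointFr dT uT; rewrite (subsetP sb _ uT).
apply/hasPn=> -[A B] /mem_contractionsP/(_ d2)[nA _ _ _]; apply/negP.
move=> /mem_contractionsP/(_ d1)[nA1 _ _ _].
have /set0Pn[u uA] := node_neq0 nA.
have u1 := subsetP (node_sub nA1) _ uA; have u2 := subsetP (node_sub nA) _ uA.
by have := disjointFr dT u1; rewrite u2.
Qed.

(** The contraction forming the lowest node that contains [u] and meets [F]:
    going down from the root, follow [u] as long as its branch meets [F]. *)
Lemma first_meeting T u (F : {set V}) : u \in supp T -> u \notin F ->
  F :&: supp T != set0 ->
  exists A B, [/\ is_contraction T A B, u \in A, [disjoint A & F] &
                  B :&: F != set0].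
Proof.
rewrite /is_contraction; elim: T => [w|T1 IH1 T2 IH2] /=.
  rewrite inE => /eqP<- uF /set0Pn[x]; rewrite !inE => /andP[xF /eqP xu].
  by rewrite -xu xF in uF.
have lift (P : pred ({set V} * {set V})) T' :
    {subset contractions T' <= P} ->
    (exists A B, [/\ ((A, B) \in contractions T') || ((B, A) \in contractions T'),
      u \in A, [disjoint A & F] & B :&: F != set0]) ->
    exists A B, [/\ ((A, B) \in P) || ((B, A) \in P),
      u \in A, [disjoint A & F] & B :&: F != set0].
  move=> sT [A [B [cAB uA dA mB]]]; exists A, B; split=> //.
  by case/orP: cAB => /sT->; rewrite ?orbT.
have s1 : {subset contractions T1 <= contractions (CNode T1 T2)}.
  by move=> p p1; rewrite inE mem_cat p1 orbT.
have s2 : {subset contractions T2 <= contractions (CNode T1 T2)}.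
  by move=> p p1; rewrite inE mem_cat p1 !orbT.
have other T' T'' : F :&: (supp T' :|: supp T'') != set0 ->
    F :&: supp T' == set0 -> supp T'' :&: F != set0.
  by rewrite setIUr => m /eqP e1; rewrite e1 set0U setIC in m.
rewrite inE => /orP[u1|u2] uF mF.
  have [m1|m1] := boolP (F :&: supp T1 != set0).
    by apply: (lift _ T1) => //; apply: IH1.
  exists (supp T1), (supp T2); rewrite inE eqxx -setI_eq0 (setIC _ F).
  by rewrite negbK in m1; split=> //; apply: other m1.
have [m2|m2] := boolP (F :&: supp T2 != set0).
  by apply: (lift _ T2) => //; apply: IH2.
exists (supp T2), (supp T1); rewrite !inE eqxx -setI_eq0 (setIC _ F) !orbT.
by rewrite negbK in m2; split=> //; apply: other m2; rewrite setUC.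
Qed.

End Trees.

(** * Cuts and costs as weights of live edges *)

Section Live.
Variables (R : realType) (V E : finType) (G : network R V E) (F : {set E}).
Implicit Types (A B : {set V}) (x : E).

(** The edges that are dimensions of the tensor contracted from [A]. *)
Definition live A x : bool :=
  adjacent G x A && (dangling G x || ~~ (ends G x \subset A)).

Lemma adjacentC A x : adjacent G x (~: A) = ~~ (ends G x \subset A).
Proof. by rewrite /adjacent setI_eq0 disjoints_subset setCK. Qed.

Hypothesis ends_neq0 : forall x, ends G x != set0.

Lemma cut_live A : cut G F A = \sum_(x in F | live A x) wt G x.
Proof.
rewrite /cut /cut2 /cut_open [RHS]big_mkcondr !big_mkcondr -big_split /=.
apply: eq_bigr => x _; rewrite adjacentC /live.
have [sA|nsA] := boolP (ends G x \subset A); last by rewrite orbT !andbT andbF addr0.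
have -> : adjacent G x A by rewrite /adjacent (setIidPl sA).
by rewrite orbF andbT add0r.
Qed.

(** The cost of a contraction is the total weight of the dimensions involved:
    an edge that is live for both sides is counted once, since two disjoint
    sides share exactly the edges adjacent to both. *)
Lemma cost_live A B : [disjoint A & B] ->
  cost G F A B = \sum_(x in F | live A x || live B x) wt G x.
Proof.
move=> dAB; rewrite /cost !cut_live /cut2 !big_mkcondr -big_split -sumrB /=.
apply: eq_bigr => x _.
(* an edge adjacent to both sides lies in neither *)
have both A' B' : [disjoint A' & B'] -> adjacent G x B' -> ends G x \subset A' = false.
  move=> dA; apply: contraTF => sA; rewrite /adjacent negbK setI_eq0.
  exact: (disjointWl sA dA).
have [aA|aA] := boolP (adjacent G x A); have [aB|aB] := boolP (adjacent G x B);
  rewrite /live ?aA ?aB ?(negPf aA) ?(negPf aB) /= ?subr0 ?addr0 ?add0r ?orbF //.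
by rewrite (both A B) // (both B A) ?(disjoint_sym B A) ?orbT ?addrK.
Qed.

End Live.

Lemma cost_sym (R : realType) (V E : finType) (G : network R V E) F A B :
  cost G F A B = cost G F B A.
Proof.
rewrite /cost [cut G F B + _]addrC; congr (_ - _); rewrite /cut2.
by apply: eq_bigl => x; rewrite [adjacent G x B && _]andbC.
Qed.

(** Every inequality between cuts below is proved edge by edge: each cut counts
    an edge with multiplicity 0 or 1, and the multiplicities are compared. *)
Lemma sum_mult_le (R : realType) (E : finType) (F : {set E}) (w : E -> R)
    (n n' : E -> nat) : (forall x, 0 <= w x) ->
  (forall x, x \in F -> (n x <= n' x)%N) ->
  \sum_(x in F) w x *+ n x <= \sum_(x in F) w x *+ n' x.
Proof.
by move=> w0 nn'; apply: ler_sum => x xF; apply: ler_wpMn2l => //; apply: nn'.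
Qed.

Lemma sum_mult (R : realType) (E : finType) (F : {set E}) (w : E -> R)
    (P : pred E) : \sum_(x in F | P x) w x = \sum_(x in F) w x *+ P x.
Proof. by rewrite big_mkcondr; apply: eq_bigr => x _; case: (P x). Qed.

Lemma sum_multD (R : realType) (E : finType) (F : {set E}) (w : E -> R)
    (n n' : E -> nat) :
  \sum_(x in F) w x *+ n x + \sum_(x in F) w x *+ n' x =
  \sum_(x in F) w x *+ (n x + n' x)%N.
Proof. by rewrite -big_split; apply: eq_bigr => x _; rewrite mulrnDr. Qed.

(** Double counting: compare both sides with the sum of [g j] over all pairs
    [(i, j)] such that [i] may be charged to [j]. *)
Lemma charging (R : realType) (I J : finType) (k : nat) (P : pred I) (Q : pred J)
    (r : I -> J -> bool) (f : I -> R) (g : J -> R) :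
  (forall j, 0 <= g j) ->
  (forall i, P i -> exists j, [/\ Q j, r i j & f i <= g j]) ->
  (forall j, Q j -> (#|[pred i | P i && r i j]| <= k)%N) ->
  \sum_(i | P i) f i <= k%:R * \sum_(j | Q j) g j.
Proof.
move=> g0 fg rk.
apply: (@le_trans _ _ (\sum_(i | P i) \sum_(j | Q j && r i j) g j)).
  apply: ler_sum => i /fg[j [Qj rij le_fg]].
  by rewrite (bigD1 j) ?Qj //= (le_trans le_fg) // lerDl sumr_ge0.
rewrite (exchange_big_dep Q) /=; last by move=> i j _ /andP[].
rewrite mulr_sumr; apply: ler_sum => j Qj.
rewrite (eq_bigl (fun i => P i && r i j)); last by move=> i; rewrite Qj.
by rewrite sumr_const mulr_natl; apply: ler_wpMn2l => //; apply: rk.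
Qed.

(** * Networks with oriented edges *)

(** The abstract situation of a sketching linearization: every edge of [F] has a
    tail and possibly a head later in the order [s]; heads and tails are active,
    and the edges with a given active tail have total weight at least [l],
    the logarithm of the sketch size. *)
Section Oriented.
Variables (R : realType) (V E : finType) (F : {set E}) (w : E -> R).
Variables (tl : E -> V) (hd : E -> option V) (s : V -> nat) (act : {set V}).
Variable l : R.
Hypothesis w_ge0 : forall x, 0 <= w x.
Hypothesis l_ge0 : 0 <= l.
Hypothesis s_inj : injective s.
Hypothesis tl_act : forall x, x \in F -> tl x \in act.
Hypothesis hd_act : forall x b, x \in F -> hd x = Some b -> b \in act.
Hypothesis tl_lt_hd : forall x b, x \in F -> hd x = Some b -> (s (tl x) < s b)%N.
Hypothesis act_out : forall a, a \in act -> l <= \sum_(x in F | tl x == a) w x.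
Implicit Types (A B : {set V}) (x : E).

Definition exits A x : bool :=
  (tl x \in A) && (if hd x is Some b then b \notin A else true).
Definition enters A x : bool :=
  (tl x \notin A) && (if hd x is Some b then b \in A else false).
Definition outw A : R := \sum_(x in F | exits A x) w x.
Definition inw A : R := \sum_(x in F | enters A x) w x.
Definition active A : bool := A :&: act != set0.
(** The edges of [F] that take part in the contraction of [A] with [B]. *)
Definition crosses A B x : bool :=
  (exits A x || enters A x) || (exits B x || enters B x).

Lemma outw_ge0 A : 0 <= outw A. Proof. exact: sumr_ge0. Qed.
Lemma inw_ge0 A : 0 <= inw A. Proof. exact: sumr_ge0. Qed.

Lemma last_active A : active A -> exists a, [/\ a \in A, a \in act &
  forall b, b \in A -> b \in act -> (s b <= s a)%N].
Proof.
case/set0Pn=> a0 a0A.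
case: (@arg_maxnP _ a0 [in A :&: act] s a0A) => a; rewrite !inE => /andP[aA aact] amax.
by exists a; split=> // b bA bact; apply: amax; rewrite inE bA.
Qed.

Lemma last_exits A a x : (forall b, b \in A -> b \in act -> (s b <= s a)%N) ->
  x \in F -> tl x = a -> forall b, hd x = Some b -> b \notin A.
Proof.
move=> amax xF xa b hx; apply/negP=> bA.
by have := amax b bA (hd_act xF hx); rewrite leqNgt -xa (tl_lt_hd xF hx).
Qed.

(** All edges whose tail is the last active vertex of [A] leave [A], since their
    heads are active and come later. *)
Lemma outw_active A : active A -> l <= outw A.
Proof.
case/last_active=> a [aA /act_out la amax]; apply: le_trans la _.
rewrite /outw !sum_mult; apply: sum_mult_le => // x xF.
have [xa|//] := eqVneq (tl x) a.
rewrite /exits xa aA; case hx: (hd x) => [b|] //.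
by rewrite (last_exits amax xF xa hx).
Qed.

(** Let [a], [b] be the last active vertices of the two sides, [a] before [b].
    The edges with tail [b] leave the union; those with tail [a] leave the union
    or enter [B].  So a union with a narrow output needs a side with a wide
    input. *)
Lemma outw_merge_in A B : [disjoint A & B] -> active A -> active B ->
  2 * l <= outw (A :|: B) + inw A \/ 2 * l <= outw (A :|: B) + inw B.
Proof.
have later A' B' a b : [disjoint A' & B'] -> a \in A' -> b \in B' ->
    a \in act -> b \in act ->
    (forall c, c \in A' -> c \in act -> (s c <= s a)%N) ->
    (forall c, c \in B' -> c \in act -> (s c <= s b)%N) ->
    (s a < s b)%N -> 2 * l <= outw (A' :|: B') + inw B'.
  move=> dAB aA bB aact bact amax bmax ltab.
  rewrite mulr_natl mulr2n; apply: le_trans (lerD (act_out aact) (act_out bact)) _.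
  rewrite /outw /inw !sum_mult !sum_multD.
  apply: sum_mult_le => // x xF; rewrite /exits /enters !inE.
  have [xa|xa] := eqVneq (tl x) a.
    have ab : (a == b) = false by apply/eqP=> ab; rewrite ab ltnn in ltab.
    rewrite xa ab aA (disjointFr dAB aA) /=; case hx: (hd x) => [c|] //.
    by rewrite inE negb_or (last_exits amax xF xa hx) /=; case: (c \in B').
  have [xb|//] := eqVneq (tl x) b.
  rewrite xb bB orbT /=; case hx: (hd x) => [c|] //.
  have cB := last_exits bmax xF xb hx.
  rewrite inE negb_or cB andbT; suff -> : c \notin A' by [].
  apply/negP=> cA; have := amax c cA (hd_act xF hx).
  by rewrite leqNgt (ltn_trans ltab) // -xb (tl_lt_hd xF hx).
move=> dAB /last_active[a [aA aact amax]] /last_active[b [bB bact bmax]].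
have [ltab|ltba|/s_inj ab] := ltngtP (s a) (s b).
- by right; apply: (later A B a b).
- by left; rewrite setUC; apply: (later B A b a) => //; rewrite disjoint_sym.
- by have := disjointFr dAB aA; rewrite ab bB.
Qed.

(** An edge leaving [A] does not leave [B], as its tail lies in only one of
    them. *)
Lemma crosses_out_in A B : [disjoint A & B] ->
  outw A + outw B + inw (A :|: B) <= \sum_(x in F | crosses A B x) w x.
Proof.
move=> dAB; rewrite /outw /inw !sum_mult !sum_multD.
apply: sum_mult_le => // x xF; rewrite /crosses /exits /enters !inE.
have dj c : c \in A -> c \in B = false by move=> cA; rewrite (disjointFr dAB cA).
case tA: (tl x \in A); case tB: (tl x \in B) => //=;
  try (by rewrite dj in tB); case hx: (hd x) => [c|] //=; rewrite ?inE;
  case cA: (c \in A); case cB: (c \in B) => //=; by rewrite dj in cB.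
Qed.

Lemma outwU_inactive A B : ~~ active B -> outw (A :|: B) = outw A.
Proof.
rewrite negbK setI_eq0 => dB; apply: eq_bigl => x.
have [xF|] //= := boolP (x \in F).
rewrite /exits !inE (disjointFl dB (tl_act xF)) orbF.
by case hx: (hd x) => [b|] //; rewrite inE (disjointFl dB (hd_act xF hx)) orbF.
Qed.

Lemma inwU_inactive A B : ~~ active B -> inw (A :|: B) = inw A.
Proof.
rewrite negbK setI_eq0 => dB; apply: eq_bigl => x.
have [xF|] //= := boolP (x \in F).
rewrite /enters !inE (disjointFl dB (tl_act xF)) orbF.
by case hx: (hd x) => [b|] //; rewrite inE (disjointFl dB (hd_act xF hx)) orbF.
Qed.

Lemma crosses_exit A B x0 : [disjoint A & B] -> x0 \in F -> exits A x0 ->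
  w x0 + outw B <= \sum_(x in F | crosses A B x) w x.
Proof.
move=> dAB x0F ex0.
have -> : w x0 = \sum_(x in F | x == x0) w x.
  by rewrite (big_pred1 x0) // => x; rewrite /= andb_idl // => /eqP->.
rewrite /outw !sum_mult !sum_multD; apply: sum_mult_le => // x xF.
have [->|_] := eqVneq x x0; last by rewrite /crosses; case: (exits B x); rewrite ?orbT.
rewrite /crosses ex0 /=; move: ex0; rewrite /exits => /andP[tA _].
by rewrite (disjointFr dAB tA).
Qed.

Variable src : {set V}.
Hypothesis src_act : src \subset act.
Hypothesis src_hd : forall x b, x \in F -> hd x = Some b -> b \notin src.

(** The condition [0 < l] only keeps the final network, whose output has weight
    [l], from being wide when [m = 1]. *)
Definition wide A : bool := (0 < l) && (3 / 2 * l <= outw A).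
Definition deep A : bool := 1 / 2 * l < inw A.

(** With [n] sources inside [A], about [n - 1] contractions of cost at least
    [m ^ 2.5] are due inside [A].  A wide output defers one of them to the next
    contraction of [A] with an active set; a deep set has an input of weight
    more than [l / 2], and its formation has already been that expensive, which
    gives one in advance. *)
Definition potential A : R :=
  let n := #|A :&: src| in
  if n == 0%N then 0 else n%:R - 1 - (wide A)%:R + (deep A)%:R.

(** Contractions of cost at least [m ^ 2.5]. *)
Let heavy A B := 5 / 2 * l <= outw A + outw B + inw (A :|: B).

(** A contraction that is not heavy never raises the potential: if it joins two
    sets with sources then, by [outw_merge_in], the union is wide or one of the
    sides is deep.  A heavy one raises it by at most 4, one for the merge and
    three for the changes of the bits. *)
Lemma potentialU A B : [disjoint A & B] ->
  potential (A :|: B) <= potential A + potential B + 4 * (heavy A B)%:R.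
Proof.
have z0 : false%:R = 0 :> R by [].
have b0 (b : bool) : 0 <= b%:R :> R by [].
have b1 (b : bool) : b%:R <= 1 :> R by rewrite lern1 leq_b1.
have srcU A' B' : [disjoint A' & B'] ->
    #|(A' :|: B') :&: src| = (#|A' :&: src| + #|B' :&: src|)%N.
  move=> dAB; rewrite setIUl; apply/eqP; rewrite (leq_card_setU _ _).2.
  exact: (disjointWl (subsetIl _ _) (disjointWr (subsetIl _ _) dAB)).
have act_src A' : #|A' :&: src| != 0%N -> active A'.
  rewrite cards_eq0 => /set0Pn[a]; rewrite inE => /andP[aA /(subsetP src_act) aact].
  by apply/set0Pn; exists a; rewrite inE aA.
have one A' B' : [disjoint A' & B'] -> #|A' :&: src| != 0%N ->
    #|B' :&: src| == 0%N ->
    potential (A' :|: B') <= potential A' + potential B' + 4 * (heavy A' B')%:R.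
  move=> dAB nA /eqP nB; rewrite /potential srcU // nB addn0 (negPf nA) eqxx addr0.
  have [aB|iB] := boolP (active B'); last first.
    by rewrite /wide /deep outwU_inactive // inwU_inactive // lerDl mulr_ge0.
  have lA := outw_active (act_src _ nA); have lB := outw_active aB.
  have i0 := inw_ge0 (A' :|: B').
  case: (boolP (heavy A' B')); rewrite /heavy ?mulr1 ?mulr0 => hv.
    have := b0 (wide (A' :|: B')); have := b1 (wide A').
    have := b1 (deep (A' :|: B')); have := b0 (deep A'); lra.
  rewrite -ltNge in hv.
  have -> : wide A' = false.
    by apply/negbTE; rewrite negb_and -ltNge; apply/orP; right; lra.
  have -> : deep (A' :|: B') = false by apply/negbTE; rewrite /deep -leNgt; lra.
  rewrite z0; have := b0 (wide (A' :|: B')); have := b0 (deep A'); lra.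
move=> dAB; have [nA|nA] := boolP (#|A :&: src| == 0%N).
  have [nB|nB] := boolP (#|B :&: src| == 0%N).
    rewrite /potential srcU // (eqP nA) (eqP nB) /= !add0r; exact: mulr_ge0.
  rewrite setUC /heavy (addrC (outw A)) [potential A + _]addrC setUC -/(heavy B A).
  by rewrite setUC; apply: one => //; rewrite disjoint_sym.
have [nB|nB] := boolP (#|B :&: src| == 0%N); first exact: one.
rewrite /potential srcU // addn_eq0 (negPf nA) (negPf nB) /= natrD.
have lA := outw_active (act_src _ nA); have lB := outw_active (act_src _ nB).
have i0 := inw_ge0 (A :|: B).
have mrg := outw_merge_in dAB (act_src _ nA) (act_src _ nB).
case: (boolP (heavy A B)); rewrite /heavy ?mulr1 ?mulr0 => hv.
  have := b0 (wide (A :|: B)); have := b1 (wide A); have := b1 (wide B).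
  have := b1 (deep (A :|: B)); have := b0 (deep A); have := b0 (deep B); lra.
rewrite -ltNge in hv.
have -> : wide A = false.
    by apply/negbTE; rewrite negb_and -ltNge; apply/orP; right; lra.
have -> : wide B = false.
    by apply/negbTE; rewrite negb_and -ltNge; apply/orP; right; lra.
have -> : deep (A :|: B) = false by apply/negbTE; rewrite /deep -leNgt; lra.
suff : 1 <= (wide (A :|: B))%:R + (deep A)%:R + (deep B)%:R :> R.
  by rewrite z0; lra.
rewrite -!natrD ler1n /wide /deep; have -> : 0 < l by lra.
case: (lerP (3 / 2 * l)) => //= oAB.
case: mrg => mrg; first by rewrite (_ : 1 / 2 * l < inw A) //; lra.
by rewrite (_ : 1 / 2 * l < inw B) ?addn1 //; lra.
Qed.

Lemma tree_potential (c : {set V} -> {set V} -> R) (T : ctree V) :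
  (forall A B, [disjoint A & B] ->
    expR (outw A + outw B + inw (A :|: B)) <= c A B) ->
  ctree_disjoint T ->
  expR (5 / 2 * l) * potential (supp T) <=
    4 * \sum_(p <- contractions T) c p.1 p.2.
Proof.
move=> le_c; elim: T => [u|T1 IH1 T2 IH2] /=.
  move=> _; rewrite big_nil mulr0 mulr_ge0_le0 ?expR_ge0 // /potential.
  have [->|/set0Pn[x]] := eqVneq ([set u] :&: src) set0; first by rewrite cards0.
  rewrite !inE => /andP[/eqP-> us].
  rewrite (setIidPl _) ?sub1set // cards1 /= subrr /deep.
  have -> : inw [set u] = 0.
    rewrite /inw big_pred0 // => y; rewrite /enters inE.
    have [yF|] //= := boolP (y \in F).
    case hy: (hd y) => [b|]; rewrite ?andbF // inE.
    have [eb|] := eqVneq b u; rewrite ?andbF //.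
    by have := src_hd yF hy; rewrite eb us.
  by rewrite ltNge mulr_ge0 //= addr0 sub0r oppr_le0.
case/and3P=> dT d1 d2; rewrite big_cons big_cat /=.
have := potentialU dT; set h := heavy _ _ => pU.
have le_h : expR (5 / 2 * l) * h%:R <= c (supp T1) (supp T2).
  have := le_c _ _ dT; case: (boolP h) => hh; last first.
    by rewrite mulr0; apply: le_trans; rewrite expR_ge0.
  by rewrite mulr1; apply: le_trans; rewrite ler_expR.
have := IH1 d1; have := IH2 d2.
have := ler_wpM2l (expR_ge0 (5 / 2 * l)) pU.
rewrite !mulrDr (mulrCA (expR _) 4) => pU' p2 p1.
lra.
Qed.

End Oriented.

Section GenericNetwork.
Variables (R : realType) (V E : finType) (G : network R V E).
Implicit Types (A : {set V}) (x : E).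

Lemma wf_ends : well_formed G -> forall x, ends G x != set0.
Proof.
by move=> wf x; rewrite -card_gt0; case: (wf x) => _; apply: leq_trans; case: ifP.
Qed.

Lemma live_one A x a : ends G x = [set a] -> dangling G x -> live G A x = (a \in A).
Proof. by move=> ex dx; rewrite /live dx /adjacent ex andbT setI_eq0 disjoints1 negbK. Qed.

Lemma live_pair A x a b : ends G x = [set a; b] -> dangling G x = false ->
  live G A x = (a \in A) (+) (b \in A).
Proof.
move=> ex dx; rewrite /live dx /adjacent ex subUset !sub1set setIUl setU_eq0.
by rewrite !setI_eq0 !disjoints1; case: (a \in A); case: (b \in A).
Qed.

Lemma live_set0 x : live G set0 x = false.
Proof. by rewrite /live /adjacent setI0 eqxx. Qed.

End GenericNetwork.

(** * The data part of a combined network *)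

Section Combined.
Variables (R : realType) (N : nat) (VD ED VE FE : finType).
Variables (GD : network R VD ED) (e : 'I_N -> ED).
Variable GE : network R VE ('I_N + FE)%type.
Let G := combine GD e GE.
Implicit Types (A B : {set (VD + VE)%type}) (C : {set VD}) (d : ED).

Definition data_part (VD VE : finType) (A : {set (VD + VE)%type}) : {set VD} :=
  [set u | inl u \in A].

Lemma data_partK C : data_part [set (inl u : VD + VE)%type | u in C] = C.
Proof. by apply/setP=> u; rewrite inE mem_imset //; apply: inl_inj. Qed.

Lemma data_partU A B : data_part (A :|: B) = data_part A :|: data_part B.
Proof. by apply/setP=> u; rewrite !inE. Qed.

Lemma ends_data d : d \notin codom e -> ends G (inl d) = [set inl u | u in ends GD d].
Proof.
move=> de; rewrite /= big_pred0 ?setU0 // => j.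
by apply: contraNF de => /eqP<-; apply: codom_f.
Qed.

Lemma live_data A d : d \notin codom e -> live G A (inl d) = live GD (data_part A) d.
Proof.
move=> de; rewrite /live /adjacent ends_data //= de andbT; congr (_ && (_ || ~~ _)).
  apply/set0Pn/set0Pn=> [[x]|[u]]; rewrite !inE => /andP[].
    by case/imsetP=> u ud -> uA; exists u; rewrite !inE ud.
  by move=> ud uA; exists (inl u); rewrite inE uA imset_f.
apply/subsetP/subsetP=> sA x.
  by move=> xd; rewrite inE; apply: sA; rewrite imset_f.
by case/imsetP=> u /sA; rewrite inE => uA ->.
Qed.

(** The logarithm of the cost of contracting [C] with [D] in [R], counted over
    the data edges that are not sketched. *)
Definition data_wt (C D : {set VD}) : R :=
  \sum_(d | (d \notin codom e) && (live GD C d || live GD D d)) wt GD d.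

Lemma data_wt_sum A B :
  \sum_(x in ~: emb_edges FE e | live G A x || live G B x) wt G x =
  data_wt (data_part A) (data_part B).
Proof.
rewrite big_sumType /= [X in _ + X]big_pred0 ?addr0; last by move=> f; rewrite !inE.
by apply: eq_bigl => d; rewrite !inE; case: (boolP (d \in _)) => //= de; rewrite !live_data.
Qed.

Lemma combine_wt (wfD : well_formed GD) (wfE : well_formed GE) x : 0 <= wt G x.
Proof. by case: x => [d|f] /=; [case: (wfD d)|case: (wfE (inr f))]. Qed.

Lemma data_wt_le (C D : {set VD}) : (forall d, 0 <= wt GD d) ->
  data_wt C set0 <= data_wt C D.
Proof.
move=> w0; rewrite /data_wt [X in X <= _]big_mkcond [X in _ <= X]big_mkcond /=.
apply: ler_sum => d _; rewrite live_set0 orbF.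
by case: (d \notin _); case: (live GD C d); case: (live GD D d); rewrite /= ?lexx ?w0.
Qed.

Lemma ends_sketched j u y : injective e -> ends GD (e j) = [set u] ->
  ends GE (inl j) = [set y] -> ends G (inl (e j)) = [set inl u; inr y].
Proof.
move=> e_inj eD eE; rewrite /= eD imset_set1 (big_pred1 j) ?eE ?imset_set1 //.
by move=> i; rewrite /= (inj_eq e_inj).
Qed.

Hypothesis endsD : forall d, ends GD d != set0.
Hypothesis endsE : forall f, ends GE f != set0.

Lemma combine_ends x : ends G x != set0.
Proof.
case: x => [d|f] /=.
  have /set0Pn[u ud] := endsD d.
  by apply/set0Pn; exists (inl u); rewrite inE imset_f.
have /set0Pn[u ud] := endsE (inr f).
by apply/set0Pn; exists (inr u); rewrite imset_f.
Qed.

Lemma cost_combine A B : [disjoint A & B] ->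
  cost G [set: _] A B = data_wt (data_part A) (data_part B) +
    \sum_(x in emb_edges FE e | live G A x || live G B x) wt G x.
Proof.
move=> dAB; rewrite (cost_live _ combine_ends) // -data_wt_sum.
rewrite (bigID (mem (emb_edges FE e))) /= addrC; congr (_ + _); apply: eq_bigl => x.
  by rewrite !inE andbC.
by rewrite in_setT /= andbC.
Qed.

(** The four coefficients multiply to [exp (cost_R(U, V))]. *)
Lemma abcd_data (p : {set VD} * {set VD}) : [disjoint p.1 & p.2] ->
  abcd GD e GE p = expR (data_wt p.1 p.2).
Proof.
move=> dp.
have d0 : coef_d GD e GE p != 0.
  by rewrite mulf_neq0 ?invr_eq0 ?mulf_neq0 // gt_eqF ?expR_gt0.
have dV : [disjoint [set (inl u : VD + VE)%type | u in p.1]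
                  & [set (inl u : VD + VE)%type | u in p.2]].
  by rewrite imset_disjoint //; apply: inl_inj.
rewrite /abcd /coef_b mulrAC mulrA divfK // -!expRD; congr expR.
rewrite -[in RHS](data_partK p.1) -[in RHS](data_partK p.2) -data_wt_sum.
by rewrite -(cost_live _ combine_ends dV) /cost; lra.
Qed.

End Combined.

(** * Sketching one edge by one matrix *)

Section Matrix.
Variables (R : realType) (N : nat) (VD ED : finType).
Variables (GD : network R VD ED) (e : 'I_N -> ED) (v : 'I_N -> VD).
Hypothesis dat : sketch_data GD e v.
Variables (m : R) (j : 'I_N).
Let Gm := matrix_net GD e m j.
Implicit Types (X Y : {set (VD + unit)%type}) (A B : {set VD}).

Lemma edge_inj : injective e.
Proof.
by move=> i k eik; apply: (data_inj dat); apply: set1_inj; rewrite -!(data_ends dat) eik.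
Qed.

Lemma matrix_edge X : live Gm X (inl (e j)) = (inl (v j) \in X) (+) (inr tt \in X).
Proof.
apply: live_pair; last by rewrite /= (codom_f (fun _ : 'I_1 => e j) ord0) andbF.
apply: (@ends_sketched _ _ _ _ _ _ _ (fun _ : 'I_1 => e j) _ ord0) => //.
  by move=> i k _; rewrite !ord1.
exact: data_ends.
Qed.

(** If [v j] is the only sketched vertex involved, a contraction costs its data
    part, the edge [e j] unless both of its ends are on the same side, and the
    output of the matrix once the matrix takes part. *)
Lemma cost_matrix X Y : [disjoint X & Y] ->
  (forall k, v k \in data_part X :|: data_part Y -> k = j) ->
  cost Gm [set: _] X Y = data_wt GD e (data_part X) (data_part Y) +
    (if ((inl (v j) \in X) (+) (inr tt \in X)) || ((inl (v j) \in Y) (+) (inr tt \in Y))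
     then wt GD (e j) else 0) +
    (if inr tt \in X :|: Y then ln m else 0).
Proof.
move=> dXY only_j.
rewrite (cost_live _ (@combine_ends _ _ _ _ _ _ _ _ _ _ _)) //; first last.
- by move=> f; apply/set0Pn; exists tt; rewrite inE.
- exact: wf_ends (data_wf dat).
rewrite big_sumType /=; congr (_ + _); last first.
  rewrite big_mkcond (big_pred1 tt) /=; last by case.
  have lt Z : live Gm Z (inr tt) = (inr tt \in Z).
    by apply: live_one; rewrite //= imset_set1.
  by rewrite !inE !lt.
rewrite (bigID (fun d => d \in codom e)) addrC /=; congr (_ + _); last first.
  rewrite /data_wt; apply: eq_bigl => d; rewrite in_setT /= andbC.
  have [//|de] := boolP (d \in codom e).
  rewrite !live_data //; apply: contraNN de => /codomP[i ->]; exact: codom_f.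
rewrite -!matrix_edge.
rewrite [RHS](_ : _ = \sum_(d | (d == e j) &&
    (live Gm X (inl (e j)) || live Gm Y (inl (e j)))) wt GD d); last first.
  by rewrite big_mkcondr big_pred1_eq.
apply: eq_bigl => d; rewrite in_setT /=.
have [->|dj] := eqVneq d (e j); first by rewrite codom_f andbT.
apply/negbTE/negP=> /andP[] + /codomP[k dk]; subst d.
have kj : e k \notin codom (fun _ : 'I_1 => e j).
  by apply/negP=> /codomP[i ek]; rewrite ek eqxx in dj.
rewrite !live_data // /live /adjacent (data_ends dat) !setI_eq0 !disjoints1 !negbK.
case/orP=> /andP[kX _]; have := only_j k; rewrite inE kX ?orbT => /(_ isT) kj'.
  by rewrite kj' eqxx in dj.
by rewrite kj' eqxx in dj.
Qed.

Lemma data_part_plain A : data_part (plain A) = A.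
Proof. exact: data_partK. Qed.

Lemma inl_plain A u : (inl u \in plain A) = (u \in A).
Proof. by rewrite mem_imset //; apply: inl_inj. Qed.

Lemma inr_plain A : (inr tt \in plain A) = false.
Proof. by apply/imsetP=> -[]. Qed.

Lemma data_part_matrix A : data_part (with_matrix v j A) = A.
Proof.
rewrite /with_matrix data_partU data_part_plain; apply/setUidPl/subsetP=> u.
by case: ifP => _; rewrite !inE.
Qed.

Lemma plain_disjoint A B : [disjoint A & B] -> [disjoint plain A & plain B].
Proof. by move=> dAB; rewrite imset_disjoint //; apply: inl_inj. Qed.

Lemma cost_apply A : sketched v A = [set j] ->
  cost Gm [set: _] (plain A) [set inr tt] = data_wt GD e A set0 + wt GD (e j) + ln m.
Proof.
move=> sA; have inA k : (v k \in A) = (k == j).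
  by rewrite -(in_set1 k) -sA inE.
have dt : data_part [set (inr tt : VD + unit)%type] = set0.
  by apply/setP=> u; rewrite !inE.
rewrite cost_matrix ?data_part_plain ?dt ?setU0.
- by rewrite inl_plain inr_plain !inE inA eqxx /= orbT.
- by rewrite disjoint_sym disjoints1 inr_plain.
- by move=> k; rewrite inA => /eqP.
Qed.

Lemma cost_before (p : {set VD} * {set VD}) : [disjoint p.1 & p.2] -> in_D v j p ->
  cost Gm [set: _] (plain p.1) (plain p.2) = data_wt GD e p.1 p.2 + wt GD (e j).
Proof.
move=> dp /eqP sp; have inp k : (v k \in p.1 :|: p.2) = (k == j).
  by rewrite -(in_set1 k) -sp [RHS]in_set.
rewrite cost_matrix ?plain_disjoint ?data_part_plain //.
  rewrite !inl_plain !inE !inr_plain /= !addbF addr0.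
  by have := inp j; rewrite inE eqxx => ->.
by move=> k; rewrite inp => /eqP.
Qed.

Lemma cost_after (p : {set VD} * {set VD}) : [disjoint p.1 & p.2] -> in_D v j p ->
  cost Gm [set: _] (with_matrix v j p.1) (with_matrix v j p.2) =
    data_wt GD e p.1 p.2 + ln m.
Proof.
move=> dp /eqP sp; have inp k : (v k \in p.1 :|: p.2) = (k == j).
  by rewrite -(in_set1 k) -sp [RHS]in_set.
have inl_wm A u : (inl u \in with_matrix v j A) = (u \in A).
  by rewrite inE inl_plain; case: ifP => _; rewrite !inE orbF.
have inr_wm A : (inr tt \in with_matrix v j A) = (v j \in A).
  by rewrite inE inr_plain; case: ifP => _; rewrite !inE.
rewrite cost_matrix ?data_part_matrix.
- rewrite !inl_wm !inr_wm !addbb /= addr0 in_setU !inr_wm.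
  by have := inp j; rewrite inE eqxx => ->.
- apply/pred0P=> -[u|[]]; rewrite /= ?inl_wm ?inr_wm.
    by apply/andP=> -[u1 u2]; rewrite (disjointFr dp u1) in u2.
  by apply/andP=> -[u1 u2]; rewrite (disjointFr dp u1) in u2.
- by move=> k; rewrite inp => /eqP.
Qed.

Lemma t_cost_le T0 A : A \in stages v T0 j -> t_cost GD e v T0 m j <= cost_at GD e v T0 m j A.
Proof.
rewrite /t_cost; elim: (stages v T0 j) (cost_at _ _ _ _ _ _ [set v j]) => // B r IH x.
rewrite inE big_cons ge_min => /orP[/eqP->|/IH le_r]; first by rewrite lexx.
by rewrite le_r orbT.
Qed.

End Matrix.

(** * Trees constrained on the data tree *)

Lemma sum_contractions (R : realType) (V : finType) (T : ctree V)
    (P : pred ({set V} * {set V})) (f : {set V} * {set V} -> R) :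
  ctree_disjoint T -> \sum_(p <- contractions T | P p) f p =
  \sum_(p | (p \in contractions T) && P p) f p.
Proof.
by move=> dT; rewrite big_mkcond big_uniq ?contractions_uniq // big_mkcondr.
Qed.

Section Constrained.
Variables (VD VE : finType) (T0 : ctree VD) (TB : ctree (VD + VE)%type).
Hypothesis d0 : ctree_disjoint T0.
Hypothesis s0 : supp T0 = [set: VD].
Hypothesis dB : ctree_disjoint TB.
Hypothesis con : constrained T0 TB.

(** By induction on the node.  For a contraction [(A, B)] with data on both
    sides, the data of [A] is a node of [T0] with some sibling [Z]; the
    contraction of [TB] with these data parts has a side that contains the same
    data as [A] and is nested with [A], which forces it to be [A]. *)
Lemma node_data_part W : W \in nodes TB ->
  data_part W = set0 \/ data_part W \in nodes T0.
Proof.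
have [n] := ubnP #|W|; elim: n W => // n IH W ltW nW.
have [[x eW]|[[A B] /= cAB eW]] := node_inv nW.
  case: x eW => [u|y] eW; [right|left].
    have -> : data_part W = [set u] by apply/setP=> z; rewrite eW !inE.
    by apply: leaf_node; rewrite s0 inE.
  by apply/setP=> z; rewrite eW !inE.
have cAB' : is_contraction TB A B by rewrite /is_contraction cAB.
have [nA nB _ dAB] := mem_contractionsP cAB dB.
have cW : #|W| = (#|A| + #|B|)%N.
  by rewrite eW; apply/eqP; rewrite (leq_card_setU A B).2.
have A0 : (0 < #|A|)%N by rewrite card_gt0 (node_neq0 nA).
have B0 : (0 < #|B|)%N by rewrite card_gt0 (node_neq0 nB).
have ltA : (#|A| < n)%N.
  by rewrite -ltnS (leq_trans _ ltW) // cW ltnS -[X in (X < _)%N]addn0 ltn_add2l.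
have ltB : (#|B| < n)%N.
  by rewrite -ltnS (leq_trans _ ltW) // cW ltnS -[X in (X < _)%N]add0n ltn_add2r.
rewrite eW data_partU.
have [-> |nA0] := IH A ltA nA; first by rewrite set0U; apply: IH.
have [-> |nB0] := IH B ltB nB; first by rewrite setU0; right.
right; have /set0Pn[a aA] := node_neq0 nA0; have /set0Pn[b bB] := node_neq0 nB0.
have bA : b \notin data_part A.
  by move: bB; rewrite !inE => bB; rewrite (disjointFl dAB bB).
have [Z cZ] : exists Z, is_contraction T0 (data_part A) Z.
  apply: node_sibling => //; apply: contraNneq bA => ->; by rewrite s0 inE.
have [_ nZ nAZ dZ] := is_contractionP d0 cZ.
have [A' [B' [cAB2 eA' eB']]] := con cZ.
have [nA' nB' _ _] := is_contractionP dB cAB2.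
suff eAA : A' = A.
  by move: cAB2 eB'; rewrite eAA => /(sibling_uniq dB cAB') <- eB; rewrite /data_part eB.
have aA2 : inl a \in A' by move: aA; rewrite -eA' inE.
have aA1 : inl a \in A by move: aA; rewrite inE.
apply/eqP; apply: contraT => neA.
have [sA|sA] := meeting_nodes dB nA' nA aA2 aA1.
  have pA : A' \proper A by rewrite properEneq neA.
  have /set0Pn[z zZ] := node_neq0 nZ.
  have zA : inl z \in A.
    apply: (subsetP (parent_sub dB cAB2 nA pA)); rewrite inE orbC.
    by move: zZ; rewrite -eB' inE => ->.
  have := disjointFl dZ zZ; by rewrite inE zA.
have pA : A \proper A' by rewrite properEneq eq_sym neA.
have bA' : inl b \in A'.
  apply: (subsetP (parent_sub dB cAB' nA' pA)); rewrite inE orbC.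
  by move: bB; rewrite inE => ->.
by case/negP: bA; rewrite -eA' inE.
Qed.

(** A contraction of [T0] is charged to a contraction of [TB] that has its two
    sides as data parts.  The latter determines the former up to the order of
    the sides, hence the factor 2. *)
Lemma charge_data (R : realType) (E : finType) (G : network R (VD + VE)%type E)
    (P : pred ({set VD} * {set VD})) (f : {set VD} * {set VD} -> R) :
  (forall p A B, p \in contractions T0 -> P p -> is_contraction TB A B ->
     data_part A = p.1 -> data_part B = p.2 -> f p <= expR (cost G [set: E] A B)) ->
  \sum_(p <- contractions T0 | P p) f p <= 2 * tree_cost G TB.
Proof.
move=> le_f; rewrite sum_contractions // /tree_cost.
rewrite [X in _ <= 2 * X]big_uniq ?contractions_uniq //=.
apply: (@charging _ _ _ 2 _ _ (fun p q =>
    (p == (data_part q.1, data_part q.2)) || (p == (data_part q.2, data_part q.1)))).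
- by move=> q; apply: expR_ge0.
- move=> p /andP[pT Pp]; have cp : is_contraction T0 p.1 p.2.
    by rewrite /is_contraction -surjective_pairing pT.
  have [A [B [cAB eA eB]]] := con cp.
  have le_p := le_f p A B pT Pp cAB eA eB.
  case/orP: (cAB) => qT; [exists (A, B)|exists (B, A)]; rewrite qT /=.
    by split=> //; rewrite /data_part eA eB -surjective_pairing eqxx.
  by split=> //; rewrite 1?cost_sym // /data_part eA eB -surjective_pairing eqxx orbT.
- move=> q _; apply: leq_trans (card_size
    [:: (data_part q.1, data_part q.2); (data_part q.2, data_part q.1)]).
  by apply: subset_leq_card; apply/subsetP=> p; rewrite !inE => /andP[].
Qed.

End Constrained.

(** * Edges of the embedding oriented by a linearization *)

Section Orientation.
Variables (R : realType) (N : nat) (VD ED VE FE : finType).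
Variables (GD : network R VD ED) (e : 'I_N -> ED) (v : 'I_N -> VD).
Variable GE : network R VE ('I_N + FE)%type.
Hypothesis dat : sketch_data GD e v.
Hypothesis emb : embedding GD e GE.
Let G := combine GD e GE.
Let F := emb_edges FE e.
Implicit Types (A B : {set (VD + VE)%type}) (x : (ED + FE)%type).

Definition sources : {set (VD + VE)%type} := [set inl (v j) | j in 'I_N].
Definition emb_vertices : {set (VD + VE)%type} := [set inr y | y in VE].
Definition active_vertices := sources :|: emb_vertices.

Lemma combined_ends x : ends G x != set0.
Proof. exact: (combine_ends e (wf_ends (data_wf dat)) (wf_ends (emb_wf emb))). Qed.

Lemma sketched_edge j : exists y, ends G (inl (e j)) = [set inl (v j); inr y].
Proof.
have /cards1P[y ey] : #|ends GE (inl j)| == 1%N by rewrite (emb_input emb j).2.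
exists y; exact: (ends_sketched (edge_inj dat) (data_ends dat j) ey).
Qed.

Lemma sketched_contracted j : dangling G (inl (e j)) = false.
Proof. by rewrite /= codom_f andbF. Qed.

Variable s : (VD + VE)%type -> nat.
Hypothesis lin : linearization s.

Definition oriented (tl : ED + FE -> VD + VE) (hd : ED + FE -> option (VD + VE)) :=
  forall x, x \in F ->
  [/\ ends G x = (if hd x is Some b then [set tl x; b] else [set tl x]),
      dangling G x = (hd x == None), tl x \in active_vertices &
      if hd x is Some b then (s (tl x) < s b)%N && (b \in emb_vertices) else true].

Lemma orientation : exists tl hd, oriented tl hd.
Proof.
pose Q x (p : (VD + VE) * option (VD + VE)) := x \in F ->
  [/\ ends G x = (if p.2 is Some b then [set p.1; b] else [set p.1]),
      dangling G x = (p.2 == None), p.1 \in active_vertices &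
      if p.2 is Some b then (s p.1 < s b)%N && (b \in emb_vertices) else true].
have [|h hP] := @choice _ _ Q; last first.
  by exists (fun x => (h x).1), (fun x => (h x).2) => x; apply: hP.
have [s_inj s_lt] := lin.
have inr_emb y : inr y \in emb_vertices by rewrite imset_f.
have inr_act y : inr y \in active_vertices by rewrite inE inr_emb orbT.
rewrite {}/Q => x; have [xF|xF] := boolP (x \in F); last first.
  have /set0Pn[a _] := combined_ends x.
  by exists (a, None) => xF'; case/negP: xF.
case: x xF => [d|f]; rewrite inE => xF.
  have /codomP[j ->] := xF; have [y ey] := sketched_edge j.
  exists (inl (v j), Some (inr y)) => _; rewrite ey sketched_contracted; split=> //=.
    by rewrite inE imset_f.
  by rewrite s_lt inr_emb.
have := emb_graph emb f; case: ifPn => [df|/negPf df] /eqP.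
  case/cards1P=> y ey; exists (inr y, None) => _.
  by split=> //=; rewrite ey imset_set1.
case/cards2P=> y [z [yz ef]].
have [yzs|zys|/s_inj[yz']] := ltngtP (s (inr y)) (s (inr z)).
- exists (inr y, Some (inr z)) => _.
  by split=> //=; rewrite ?yzs ?inr_emb // ef imsetU1 imset_set1.
- exists (inr z, Some (inr y)) => _.
  by split=> //=; rewrite ?zys ?inr_emb // ef imsetU1 imset_set1 setUC.
- by rewrite yz' eqxx in yz.
Qed.

Variables (tl : ED + FE -> VD + VE) (hd : ED + FE -> option (VD + VE)).
Hypothesis ori : oriented tl hd.

Lemma live_oriented A x : x \in F -> live G A x = exits tl hd A x || enters tl hd A x.
Proof.
move=> xF; have [ex dx _ _] := ori xF; rewrite /exits /enters.
case hx: (hd x) ex dx => [b|] ex dx.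
  by rewrite (live_pair _ ex dx); case: (tl x \in A); case: (b \in A).
by rewrite (live_one _ ex dx) andbT andbF orbF.
Qed.

Lemma leaves_exits A x : x \in F -> leaves GD e GE s x A = exits tl hd A x.
Proof.
move=> xF; have [ex dx _ sx] := ori xF; rewrite /leaves /exits -/G dx.
case hx: (hd x) ex dx sx => [b|] ex dx sx; last first.
  by rewrite eqxx /adjacent ex setI_eq0 disjoints1 negbK andbT.
rewrite ex; case/andP: sx => ltab _; rewrite (_ : (Some b == None) = false) //.
apply/existsP/andP=> [[a0]|[aA bA]].
  rewrite !inE => /andP[/andP[/orP[]/eqP-> a0A]] /existsP[b0];
  rewrite !inE => /andP[/andP[b0A /orP[]/eqP eb]] lt; subst b0; rewrite ?a0A //.
  - by rewrite ltnn in lt.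
  - by have := ltn_trans lt ltab; rewrite ltnn.
  - by rewrite ltnn in lt.
exists (tl x); rewrite !inE eqxx aA /=; apply/existsP; exists b.
by rewrite !inE eqxx orbT bA.
Qed.

Lemma sketched_oriented j : exists y, tl (inl (e j)) = inl (v j) /\
  hd (inl (e j)) = Some (inr y).
Proof.
have jF : inl (e j) \in F by rewrite inE codom_f.
have [ex dx _ sx] := ori jF; have [y ey] := sketched_edge j.
exists y; case hx: (hd _) ex dx sx => [b|] ex dx; last by rewrite sketched_contracted in dx.
case/andP=> _ /imsetP[y' _ eb].
have : inl (v j) \in [set tl (inl (e j)); b] by rewrite -ex ey !inE eqxx.
have : b \in [set inl (v j); inr y] by rewrite -ey ex !inE eqxx orbT.
by rewrite eb !inE orbF => /eqP-> /eqP->.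
Qed.

Lemma cost_split A B : [disjoint A & B] ->
  cost G [set: _] A B = data_wt GD e (data_part A) (data_part B) +
    \sum_(x in F | crosses tl hd A B x) wt G x.
Proof.
move=> dAB; rewrite (cost_combine _ (wf_ends (data_wf dat)) (wf_ends (emb_wf emb))) //.
congr (_ + _); apply: eq_bigl => x; apply: andb_id2l => xF.
by rewrite !live_oriented.
Qed.

End Orientation.

(** * Lower bounds for a constrained tree *)

Section LowerBounds.
Variables (R : realType) (N : nat) (VD ED VE FE : finType).
Variables (GD : network R VD ED) (e : 'I_N -> ED) (v : 'I_N -> VD).
Variable GE : network R VE ('I_N + FE)%type.
Hypothesis dat : sketch_data GD e v.
Hypothesis emb : embedding GD e GE.
Let G := combine GD e GE.
Let F := emb_edges FE e.
Let m := sketch_size GE.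
Let l := ln m.
Let w_ge0 x : 0 <= wt G x := combine_wt e (data_wf dat) (emb_wf emb) x.

Lemma ln_sketch_size : l = \sum_(f in output_edges GE) wt GE (inr f).
Proof. by rewrite /l /m /sketch_size expRK. Qed.

Lemma ln_sketch_size_ge0 : 0 <= l.
Proof. by rewrite ln_sketch_size; apply: sumr_ge0 => f _; case: (emb_wf emb (inr f)). Qed.
Let l_ge0 := ln_sketch_size_ge0.

Lemma sketch_sizeE : m = expR l.
Proof. by rewrite /l lnK // posrE expR_gt0. Qed.

Variables (s : (VD + VE)%type -> nat).
Variables (tl : ED + FE -> VD + VE) (hd : ED + FE -> option (VD + VE)).
Hypothesis lin : linearization s.
Hypothesis ori : oriented GD e v GE s tl hd.
Hypothesis vertex_out : forall y : VE, l <= cut_lin GD e GE s [set inr y].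
Hypothesis input_wt : forall j, l <= wt GD (e j).
Implicit Types (A B : {set (VD + VE)%type}).

Let act := active_vertices VE v.
Let act_set A := active act A.

Let tl_act x : x \in F -> tl x \in act.
Proof. by case/ori. Qed.

Let hd_emb x b : x \in F -> hd x = Some b -> b \in emb_vertices VD VE.
Proof. by case/ori=> _ _ _ + hx; rewrite hx => /andP[]. Qed.

Let hd_act x b : x \in F -> hd x = Some b -> b \in act.
Proof. by move=> xF /(hd_emb xF) bE; rewrite inE bE orbT. Qed.

Let tl_lt_hd x b : x \in F -> hd x = Some b -> (s (tl x) < s b)%N.
Proof. by case/ori=> _ _ _ + hx; rewrite hx => /andP[]. Qed.

Let act_out a : a \in act -> l <= \sum_(x in F | tl x == a) wt G x.
Proof.
rewrite inE => /orP[/imsetP[j _ ->]|/imsetP[y _ ->]].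
  have jF : inl (e j) \in F by rewrite inE codom_f.
  have [y [tj _]] := sketched_oriented dat emb ori j.
  apply: le_trans (input_wt j) _; rewrite (bigD1 (inl (e j))) /=; last by rewrite jF tj eqxx.
  by rewrite lerDl; apply: sumr_ge0 => x _; apply: w_ge0.
apply: le_trans (vertex_out y) _; rewrite /cut_lin le_eqVlt; apply/orP; left.
apply/eqP/eq_bigl => x; apply: andb_id2l => xF.
rewrite (leaves_exits ori) // /exits inE; case hx: (hd x) => [b|]; rewrite ?andbT //.
rewrite inE; have [<-|//] := eqVneq (tl x) (inr y).
by apply/eqP=> eb; have := tl_lt_hd xF hx; rewrite eb ltnn.
Qed.

Let out_active A : act_set A -> l <= outw F (wt G) tl hd A.
Proof. exact: (outw_active w_ge0 hd_act tl_lt_hd act_out). Qed.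

Lemma active_data A j : v j \in data_part A -> act_set A.
Proof.
rewrite inE => jA; apply/set0Pn; exists (inl (v j)).
by rewrite !inE jA imset_f.
Qed.

(** The logarithm of the share of the embedding in the cost of contracting [A]
    with [B]. *)
Definition emb_cost A B : R := \sum_(x in F | crosses tl hd A B x) wt G x.

Lemma emb_costC A B : emb_cost A B = emb_cost B A.
Proof. by apply: eq_bigl => x; rewrite /crosses [in RHS]orbC. Qed.

Lemma emb_cost_ge0 A B : 0 <= emb_cost A B.
Proof. exact: sumr_ge0. Qed.

(** The edges leaving the last active vertex of an active side remain. *)
Lemma emb_cost_active1 A B : [disjoint A & B] -> act_set A -> l <= emb_cost A B.
Proof.
move=> dAB aA; apply: le_trans (crosses_out_in _ _ _ w_ge0 dAB).
have := out_active aA; have := outw_ge0 F tl hd w_ge0 B.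
have := inw_ge0 F tl hd w_ge0 (A :|: B); lra.
Qed.

Lemma emb_cost_active2 A B : [disjoint A & B] -> act_set A -> act_set B ->
  l + l <= emb_cost A B.
Proof.
move=> dAB aA aB; apply: le_trans (crosses_out_in _ _ _ w_ge0 dAB).
have := out_active aA; have := out_active aB.
have := inw_ge0 F tl hd w_ge0 (A :|: B); lra.
Qed.

(** As long as [v j] has not met an embedding vertex, the edge [e j] itself is
    one of the dimensions. *)
Lemma emb_cost_input A B j : [disjoint A & B] -> v j \in data_part A ->
  [disjoint A & emb_vertices VD VE] -> wt GD (e j) + outw F (wt G) tl hd B <= emb_cost A B.
Proof.
move=> dAB; rewrite inE => jA dA.
have [y [tj hj]] := sketched_oriented dat emb ori j.
apply: (crosses_exit w_ge0 dAB (x0 := inl (e j))); first by rewrite inE codom_f.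
by rewrite /exits tj hj jA (disjointFl dA) // imset_f.
Qed.

Lemma cost_emb_cost A B : [disjoint A & B] ->
  cost G [set: _] A B = data_wt GD e (data_part A) (data_part B) + emb_cost A B.
Proof. exact: (cost_split dat emb ori). Qed.

Variables (T0 : ctree VD) (TB : ctree (VD + VE)%type).
Hypothesis d0 : ctree_disjoint T0.
Hypothesis s0 : supp T0 = [set: VD].
Hypothesis dB : ctree_disjoint TB.
Hypothesis sB : supp TB = [set: (VD + VE)%type].
Hypothesis con : constrained T0 TB.

Let abcdE p : p \in contractions T0 -> abcd GD e GE p = expR (data_wt GD e p.1 p.2).
Proof.
case: p => P Q pT; have [_ _ _ dp] := mem_contractionsP pT d0.
exact: (abcd_data e (wf_ends (data_wf dat)) (wf_ends (emb_wf emb))).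
Qed.

Lemma bound_S : \sum_(p <- contractions T0 | in_S v p) abcd GD e GE p * m ^+ 2
  <= 2 * tree_cost G TB.
Proof.
apply: (charge_data d0 dB con) => p A B pT pS cAB eA eB.
have [_ _ _ dAB] := is_contractionP dB cAB.
case/andP: pS => /set0Pn[j] + /set0Pn[k]; rewrite !inE -eA -eB => jA kB.
rewrite abcdE // sketch_sizeE expr2 -!expRD ler_expR cost_emb_cost // eA eB lerD2l.
by apply: emb_cost_active2 => //; [apply: active_data jA|apply: active_data kB].
Qed.

Lemma bound_I s' : \sum_(p <- contractions T0 | in_I v p) z_term GD e GE s' p
  <= 2 * tree_cost G TB.
Proof.
apply: (charge_data d0 dB con) => p A B pT _ cAB eA eB.
have [_ _ _ dAB] := is_contractionP dB cAB.
rewrite /z_term abcdE // cost_emb_cost // eA eB expRD ler_wpM2l ?expR_ge0 //.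
rewrite ge_min; have [p0|] := eqVneq (sketched v (p.1 :|: p.2)) set0; last first.
  case/set0Pn=> j; rewrite inE in_setU -eA -eB => jAB; apply/orP; right.
  rewrite -/m sketch_sizeE ler_expR; case/orP: jAB => /active_data act_j.
    exact: emb_cost_active1.
  by rewrite emb_costC; apply: emb_cost_active1; rewrite 1?disjoint_sym.
apply/orP; left; rewrite ler_expR; apply: le_trans (emb_cost_ge0 _ _).
rewrite /cut_lin big_pred0 // => x.
(* without sketched vertices, no edge of the embedding meets the data *)
have [xF|] //= := boolP (x \in F).
rewrite (_ : leaves _ _ _ _ _ _ = false) //; apply/negbTE/negP.
have no_v j : (inl (v j) \in [set (inl u : VD + VE)%type | u in p.1 :|: p.2]) = false.
  rewrite mem_imset; last exact: inl_inj.
  by have := in_set0 j; rewrite -p0 inE.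
have no_y y : (inr y \in [set (inl u : VD + VE)%type | u in p.1 :|: p.2]) = false.
  by apply/imsetP=> -[].
have no_x a : a \in ends G x -> a \notin [set (inl u : VD + VE)%type | u in p.1 :|: p.2].
  case: x xF => [d|f]; rewrite inE.
    case/codomP=> j ->; have [y ->] := sketched_edge dat emb j.
    by rewrite !inE => /orP[/eqP->|/eqP->]; rewrite ?no_v ?no_y.
  by move=> _ /imsetP[y _ ->]; rewrite no_y.
rewrite /leaves; case: ifP => _.
  by case/set0Pn=> a /setIP[/no_x/negP].
by case/existsP=> a /andP[/setIP[/no_x/negP]].
Qed.

Lemma outw_setT : outw F (wt G) tl hd [set: _] = l.
Proof.
rewrite ln_sketch_size /outw big_sumType /= big_pred0 ?add0r.
  apply: eq_bigl => f; have fF : inr f \in F by rewrite inE.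
  have [_ df _ _] := ori fF; rewrite fF inE -[dangling GE _]/(dangling G (inr f)) df.
  by rewrite /exits inE; case: (hd _) => [b|] //=; rewrite inE.
move=> d; have [/= dF|] //= := boolP (inl d \in F).
have [_ dd _ _] := ori dF; rewrite /exits inE /=; case hx: (hd _) dd => [b|].
  by rewrite inE.
by move: dF; rewrite inE /= => ->; rewrite andbF.
Qed.

(** The whole network has potential at least [N - 1], and [N <= 2 * (N - 1)]. *)
Lemma bound_N : (1 < N)%N -> N%:R * m `^ (5 / 2) <= 8 * tree_cost G TB.
Proof.
move=> N1; have [s_inj _] := lin.
have pot : expR (5 / 2 * l) * potential F (wt G) tl hd l (sources VE v) (supp TB)
    <= 4 * tree_cost G TB.
  have src_act : sources VE v \subset act by apply: subsetUl.
  have src_hd x b : x \in F -> hd x = Some b -> b \notin sources VE v.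
    by move=> xF /(hd_emb xF)/imsetP[y _ ->]; apply/imsetP=> -[].
  apply: (tree_potential w_ge0 l_ge0 s_inj tl_act hd_act tl_lt_hd act_out src_act src_hd
    (c := fun A B => expR (cost G [set: _] A B))) => //.
  move=> A B dAB; rewrite ler_expR cost_emb_cost //.
  apply: le_trans (crosses_out_in _ _ _ w_ge0 dAB) _.
  rewrite lerDr; apply: sumr_ge0 => d _; exact: (data_wf dat d).1.
have cN : #|supp TB :&: sources VE v| = N.
  rewrite sB setTI card_imset ?card_ord // => i k [].
  exact: (data_inj dat).
have le_pot : N%:R - 1 <= potential F (wt G) tl hd l (sources VE v) (supp TB).
  rewrite /potential cN gtn_eqF ?(ltnW N1) //.
  have -> : wide F (wt G) tl hd l (supp TB) = false.
    rewrite /wide sB outw_setT; case: ltrP => //= ll; apply/negbTE; rewrite -ltNge; lra.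
  by rewrite subr0 lerDl.
have := ler_wpM2l (expR_ge0 (5 / 2 * l)) le_pot.
have -> : m `^ (5 / 2) = expR (5 / 2 * l) by rewrite /powR gt_eqF // sketch_sizeE expR_gt0.
have N2 : 2 <= N%:R :> R by rewrite ler_nat.
have := ler_wpM2l (expR_ge0 (5 / 2 * l)) N2.
rewrite mulrBr mulr1 [N%:R * _]mulrC; lra.
Qed.

(** Let [(W1, W2)] be the contraction at which [v j] first meets another active
    vertex, with [v j] in [W1].  The data of [W1] is a stage of [e j], and
    applying the matrix at this stage costs no more than [(W1, W2)], which has
    [e j] and the edges leaving the last active vertex of [W2] as dimensions.
    Up to this stage the contractions of [D(e j)] still carry [e j] in [TB];
    later ones carry a weight of at least [l], like those with the matrix. *)
Lemma t_charge j : exists A : {set VD}, [/\ A \in stages v T0 j,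
  exists q, [/\ q \in contractions TB,
    (sketched v (data_part q.1) == [set j]) || (sketched v (data_part q.2) == [set j]) &
    expR (cost (matrix_net GD e m j) [set: _] (plain A) [set inr tt])
      <= expR (cost G [set: _] q.1 q.2)] &
  forall p A' B', p \in contractions T0 -> in_D v j p -> is_contraction TB A' B' ->
    data_part A' = p.1 -> data_part B' = p.2 ->
    (if p.1 :|: p.2 \subset A
     then expR (cost (matrix_net GD e m j) [set: _] (plain p.1) (plain p.2))
     else expR (cost (matrix_net GD e m j) [set: _]
            (with_matrix v j p.1) (with_matrix v j p.2)))
    <= expR (cost G [set: _] A' B')].
Proof.
have vj_act : inl (v j) \in act by rewrite !inE imset_f.
have [y _] := sketched_oriented dat emb ori j.
(* the contraction at which v j first meets another active vertex *)
have [W1 [W2 [cW jW1 dW1 mW2]]] : exists A B, [/\ is_contraction TB A B,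
    inl (v j) \in A, [disjoint A & act :\ inl (v j)] & B :&: (act :\ inl (v j)) != set0].
  apply: first_meeting; rewrite ?sB ?inE ?eqxx // setIT.
  by apply/set0Pn; exists (inr y); rewrite !inE imset_f // orbT.
have [nW1 nW2 _ dW] := is_contractionP dB cW.
have aW2 : act_set W2.
  case/set0Pn: mW2 => x; rewrite !inE => /and3P[xW _ xact].
  by apply/set0Pn; exists x; rewrite !inE xW.
have emb_W1 (X : {set (VD + VE)%type}) : X \subset W1 -> [disjoint X & emb_vertices VD VE].
  move=> sX; apply: (disjointWl sX); apply: (disjointWr _ dW1).
  by apply/subsetP=> x xE; rewrite !inE xE orbT andbT; case/imsetP: xE => z _ ->.
have jD1 : v j \in data_part W1 by rewrite inE.
have sk : sketched v (data_part W1) = [set j].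
  apply/setP=> k; rewrite !inE; apply/idP/eqP=> [kW|->//].
  apply: (data_inj dat); apply/eqP; apply: contraT => nkj.
  have := disjointFr dW1 kW; rewrite !inE imset_f // andbT => /negbFE/eqP[] eqv.
  by rewrite eqv eqxx in nkj.
exists (data_part W1); split.
- have nD : data_part W1 \in nodes T0.
    have [D0|//] := node_data_part d0 s0 dB con nW1.
    by rewrite D0 inE in jD1.
  rewrite inE; have [[u eu]|[p pT ep]] := node_inv nD.
    by move: jD1; rewrite eu inE => /eqP->; rewrite eqxx.
  apply/orP; right; rewrite ep; apply/mapP; exists p => //.
  by rewrite mem_filter pT andbT /in_D -ep sk.
- have le_W : cost (matrix_net GD e m j) [set: _] (plain (data_part W1)) [set inr tt]
      <= cost G [set: _] W1 W2.
    rewrite (cost_apply dat _ sk) cost_emb_cost // -addrA.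
    apply: lerD; first by apply: data_wt_le => d; exact: (data_wf dat d).1.
    apply: le_trans (emb_cost_input dW jD1 (emb_W1 _ (subxx _))).
    by rewrite lerD2l out_active.
  case/orP: (cW) => qT; [exists (W1, W2)|exists (W2, W1)].
    by rewrite qT /= sk eqxx ler_expR.
  by rewrite qT /= sk eqxx orbT ler_expR [X in _ <= X]cost_sym.
- move=> p A' B' pT pD cAB eA eB; have [nA nB _ dAB] := is_contractionP dB cAB.
  have [n1 n2 _ dp] : [/\ p.1 \in nodes T0, p.2 \in nodes T0,
      p.1 :|: p.2 \in nodes T0 & [disjoint p.1 & p.2]].
    by case: p pT {pD eA eB} => P Q pT; apply: mem_contractionsP.
  have jp : (v j \in p.1) || (v j \in p.2).
    by rewrite -in_setU; have := set11 j; rewrite -(eqP pD) inE.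
  (* up to the chosen stage, the side with v j lies inside W1 and so contains
     no embedding vertex *)
  have early (X Y : {set (VD + VE)%type}) :
      [disjoint X & Y] -> X \in nodes TB -> v j \in data_part X ->
      data_part Y != set0 -> data_part X :|: data_part Y \subset data_part W1 ->
      wt GD (e j) <= emb_cost X Y.
    move=> dXY nX jX Y0 sXY.
    have sX : X \subset W1.
      have jX' : inl (v j) \in X by rewrite inE in jX.
      have [//|sWX] := meeting_nodes dB nX nW1 jX' jW1.
      case/set0Pn: Y0 => u uY; have uW : u \in data_part W1.
        by apply: (subsetP sXY); rewrite inE uY orbT.
      rewrite inE in uY; rewrite inE in uW.
      by have := disjointFl dXY uY; rewrite (subsetP sWX _ uW).
    apply: le_trans (emb_cost_input dXY jX (emb_W1 _ sX)).
    by rewrite lerDl outw_ge0.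
  case: ifP => sp; rewrite ler_expR cost_emb_cost // eA eB.
    rewrite (cost_before dat) // lerD2l; case/orP: jp => jp.
      by apply: early; rewrite ?eA ?eB // (node_neq0 n2).
    rewrite emb_costC; apply: early; rewrite ?eA ?eB ?(node_neq0 n1) //.
      by rewrite disjoint_sym.
    by rewrite setUC.
  rewrite (cost_after dat) // lerD2l -/l; case/orP: jp => jp.
    by apply: emb_cost_active1 => //; apply: (@active_data _ j); rewrite eA.
  rewrite emb_costC; apply: emb_cost_active1; first by rewrite disjoint_sym.
  by apply: (@active_data _ j); rewrite eB.
Qed.

(** A contraction serves as [(W1, W2)] for at most two [j], one for each side,
    because [v j] is the only sketched vertex of [W1]; and every contraction of
    [T0] belongs to at most one [D(e j)]. *)
Lemma bound_t : \sum_(j < N) t_cost GD e v T0 m j <= 4 * tree_cost G TB.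
Proof.
have [A AP] := choice t_charge.
pose h j p : R := if p.1 :|: p.2 \subset A j
     then expR (cost (matrix_net GD e m j) [set: _] (plain p.1) (plain p.2))
     else expR (cost (matrix_net GD e m j) [set: _]
            (with_matrix v j p.1) (with_matrix v j p.2)).
have apply_le :
    \sum_(j < N) expR (cost (matrix_net GD e m j) [set: _] (plain (A j)) [set inr tt])
    <= 2 * tree_cost G TB.
  rewrite /tree_cost [X in _ <= 2 * X]big_uniq ?contractions_uniq //=.
  apply: (@charging _ _ _ 2 _ _ (fun j q =>
    (sketched v (data_part q.1) == [set j]) || (sketched v (data_part q.2) == [set j]))).
  - by move=> q; apply: expR_ge0.
  - by move=> j _; have [_ [q [qT rq le_q]] _] := AP j; exists q.
  - move=> q _; rewrite -(card_imset _ (@set1_inj 'I_N)).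
    apply: leq_trans (card_size [:: sketched v (data_part q.1); sketched v (data_part q.2)]).
    apply: subset_leq_card; apply/subsetP=> S /imsetP[j]; rewrite !inE => + ->.
    by rewrite ![[set j] == _]eq_sym.
have stage_le : \sum_(j < N) \sum_(p <- contractions T0 | in_D v j p) h j p
    <= 2 * tree_cost G TB.
  rewrite (exchange_big_dep predT) //=; apply: (charge_data d0 dB con).
  move=> p A' B' pT _ cAB eA eB.
  have [/existsP[j pD]|/existsPn pD] := boolP [exists j, in_D v j p].
    rewrite (big_pred1 j); last first.
      by move=> k; rewrite /= /in_D (eqP pD) (inj_eq set1_inj) eq_sym.
    by have [_ _] := AP j; apply.
  by rewrite big_pred0 ?expR_ge0 // => j; apply/negbTE.
have -> : 4 * tree_cost G TB = 2 * tree_cost G TB + 2 * tree_cost G TB by lra.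
apply: le_trans (lerD apply_le stage_le); rewrite -big_split /=.
by apply: ler_sum => j _; have [st _ _] := AP j; apply: t_cost_le.
Qed.

End LowerBounds.

(** * The lower bound on the sketching cost *)

Theorem theoremD9 (R : realType) (k1 k2 : R) (hk1 : 0 < k1) (hk2 : 0 < k2) :
  exists c : R, 0 < c /\
  forall (N : nat) (VD ED VE FE : finType)
    (GD : network R VD ED) (e : 'I_N -> ED) (v : 'I_N -> VD)
    (T0 : ctree VD)
    (GE : network R VE ('I_N + FE)%type)
    (TB : ctree (VD + VE)%type)
    (eps delta : R) (s : (VD + VE)%type -> nat),
  let m := sketch_size GE in
  sketch_data GD e v ->
  contraction_tree T0 ->
  embedding GD e GE ->
  (forall j, m < expR (wt GD (e j))) ->
  0 < eps -> 0 < delta < 1 ->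
  accurate_condition GD e GE k1 k2 eps delta ->
  contraction_tree TB ->
  constrained T0 TB ->
  linearization s ->
  ((N <= #|VE|)%N -> c * (N%:R * ln (1 / delta) / eps ^+ 2) <= m) /\
  c * (\sum_(j < N) t_cost GD e v T0 m j
       + \sum_(p <- contractions T0 | in_S v p) abcd GD e GE p * m ^+ 2
       + (if (1 < N)%N then N%:R * m `^ (5 / 2) else 0)
       + \sum_(p <- contractions T0 | in_I v p) z_term GD e GE s p)
  <= tree_cost (combine GD e GE) TB.
Proof.
(* k1 is for the bound on m; 16 = 4 + 2 + 8 + 2 adds the factors in bound_t,
   bound_S, bound_N and bound_I *)
exists (Num.min k1 (1 / 16)); split; first by rewrite lt_min hk1; lra.
move=> N VD ED VE FE GD e v T0 GE TB eps delta s m dat /andP[d0 /eqP s0] emb.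
move=> big eps0 /andP[delta0 delta1] [_ /andP[le_m _] [s' [lin' out']]].
move=> /andP[dB /eqP sB] con _; split.
  have ln0 : 0 <= ln (1 / delta).
    by apply: ln_ge0; rewrite div1r invf_ge1 // ltW.
  move=> NV; apply: le_trans le_m; apply: ler_pM.
  - by rewrite le_min ltW //=; lra.
  - by apply: divr_ge0; [apply: mulr_ge0|apply/exprn_ge0/ltW].
  - by rewrite ge_min lexx.
  - rewrite ler_pM2r ?invr_gt0 ?exprn_gt0 //; apply: ler_wpM2r => //.
    by rewrite ler_nat.
have input_wt j : ln m <= wt GD (e j).
  rewrite -[leRHS]expRK ler_ln ?posrE ?expR_gt0 //; exact: ltW.
have [tl [hd ori]] := orientation dat emb lin'.
have bt := bound_t dat emb ori out' input_wt d0 s0 dB sB con.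
have bS := bound_S dat emb ori out' input_wt d0 dB con.
have bI := bound_I dat emb ori out' input_wt d0 dB con s.
have bN : (if (1 < N)%N then N%:R * m `^ (5 / 2) else 0)
    <= 8 * tree_cost (combine GD e GE) TB.
  case: ifP => N1; first exact: (bound_N dat emb lin' ori out' input_wt dB sB).
  by apply: mulr_ge0 => //; apply: sumr_ge0 => q _; apply: expR_ge0.
set X := (X in _ * X <= _).
have le_X : X <= 16 * tree_cost (combine GD e GE) TB by rewrite /X; lra.
have c16 : Num.min k1 (1 / 16) <= 1 / 16 by rewrite ge_min lexx orbT.
have c0 : 0 <= Num.min k1 (1 / 16) by rewrite le_min ltW //=; lra.
have C0 : 0 <= tree_cost (combine GD e GE) TB.
  by apply: sumr_ge0 => q _; apply: expR_ge0.
apply: le_trans (ler_wpM2l c0 le_X) _.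
have := ler_wpM2r C0 c16; lra.
Qed.
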